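(* For every countable ordinal $\alpha$ there is a position in the variant of infinite draughts played with neither the forced-jump rule nor the forced-iterated-jump rule, whose game value, with Red as the open player, is exactly $\alpha$.
   Context: Infinite draughts is played by two players, Black and Red, on the infinite checkerboard $\mathbb{Z}\times\mathbb{Z}$, using only the dark squares (say those $(x,y)$ with $x+y$ even). A position consists of an arbitrary (possibly infinite) placement of pieces on dark squares, each piece being a black or red pawn or king, together with a specification of which player is to move. Black pawns move only on upward diagonals, red pawns only on downward diagonals; kings may move along all four diagonal directions. A simple move moves a piece one diagonal step, in a permitted direction, to an empty square. A jump moves a piece over a diagonally adjacent enemy piece (in a permitted direction) to the empty square immediately beyond; the jumped enemy piece is captured and removed. A single piece may perform several jumps in succession (an iterated jump), which together count as one turn. If a piece performs an infinite iterated jump, then all enemy pieces jumped are removed and the jumping piece itself is also removed from the board. There is no promotion of pawns. A player loses when it is their turn and they have no legal move; the other player then wins. Infinitely long play is a draw. In the variant considered here, jumping is never obligatory: a player may make any simple move or any (finite or infinite) jump sequence, stopping an iterated jump at any point. Game values (with respect to a designated ''open'' player, here Red) are defined by transfinite recursion: (1) a position in which the game is already won for the open player has value $0$; (2) if the game is not yet won and it is the open player's turn, and the open player can move to a position having a value, then the value is $\alpha+1$ where $\alpha$ is the least value of a position reachable in one legal move; (3) if it is the closed player's turn and every position reachable by a legal move has a value, then the value is the supremum of those values; otherwise the value is undefined. *)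

(* Defs.v *)
From Stdlib Require Import ZArith.
Open Scope Z_scope.

Inductive color := Black | Red.
Inductive kind := Pawn | King.
Record piece := Piece { pcolor : color; pkind : kind }.

Definition square := (Z * Z)%type.
Definition dark (s : square) : Prop := Z.Even (fst s + snd s).
Definition board := square -> option piece.

Record position := Pos { pboard : board; pturn : color }.

Definition valid_position (p : position) : Prop :=
  forall s, ~ dark s -> pboard p s = None.

Definition other (c : color) : color :=
  match c with Black => Red | Red => Black end.

Definition allowed_dir (pc : piece) (dx dy : Z) : Prop :=
  (dx = 1 \/ dx = -1) /\
  match pkind pc with
  | King => dy = 1 \/ dy = -1
  | Pawn => match pcolor pc with Black => dy = 1 | Red => dy = -1 end
  end.

Definition shift (s : square) (k dx dy : Z) : square :=
  (fst s + k * dx, snd s + k * dy).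

Definition sq_eqb (x y : square) : bool :=
  (fst x =? fst y) && (snd x =? snd y).

Definition update (b : board) (s : square) (v : option piece) : board :=
  fun x => if sq_eqb x s then v else b x.

Definition simple_move (b : board) (c : color) (b' : board) : Prop :=
  exists s pc dx dy,
    b s = Some pc /\ pcolor pc = c /\ allowed_dir pc dx dy /\
    b (shift s 1 dx dy) = None /\
    b' = update (update b s None) (shift s 1 dx dy) (Some pc).

Definition jump_step (pc : piece) (b : board) (s : square)
    (b' : board) (s' : square) : Prop :=
  exists dx dy,
    allowed_dir pc dx dy /\ b s = Some pc /\
    (exists e, b (shift s 1 dx dy) = Some e /\ pcolor e <> pcolor pc) /\
    b (shift s 2 dx dy) = None /\
    s' = shift s 2 dx dy /\
    b' = update (update (update b s None) (shift s 1 dx dy) None) s' (Some pc).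

Inductive jchain (pc : piece) : board -> square -> board -> square -> Prop :=
| jc_one b s b' s' : jump_step pc b s b' s' -> jchain pc b s b' s'
| jc_more b s b1 s1 b' s' :
    jump_step pc b s b1 s1 -> jchain pc b1 s1 b' s' -> jchain pc b s b' s'.

Definition midpoint (s s' : square) : square :=
  ((fst s + fst s') / 2, (snd s + snd s') / 2).

(* infinite iterated jump of pc starting at s0: all jumped pieces are removed
   and the jumping piece itself is removed *)
Definition inf_jump (pc : piece) (b : board) (s0 : square) (b' : board) : Prop :=
  exists (ss : nat -> square) (bs : nat -> board),
    ss 0%nat = s0 /\ bs 0%nat = b /\
    (forall n, jump_step pc (bs n) (ss n) (bs (S n)) (ss (S n))) /\
    (forall x,
       let touched := exists n, x = ss n \/ x = midpoint (ss n) (ss (S n)) in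
       (touched -> b' x = None) /\ (~ touched -> b' x = b x)).

Definition move (p q : position) : Prop :=
  pturn q = other (pturn p) /\
  exists b' : board,
    (forall x, pboard q x = b' x) /\
    ( simple_move (pboard p) (pturn p) b'
    \/ (exists pc s s', pcolor pc = pturn p /\ jchain pc (pboard p) s b' s')
    \/ (exists pc s, pcolor pc = pturn p /\ inf_jump pc (pboard p) s b') ).

Definition won_open (p : position) : Prop :=
  pturn p = Black /\ forall q, ~ move p q.

(* countable ordinals as Brouwer trees with countable limits *)
Inductive ord : Type :=
| OZ : ord
| OS : ord -> ord
| OL : (nat -> ord) -> ord.

Inductive ole : ord -> ord -> Prop :=
| ole_zero x : ole OZ x
| ole_trans x y z : ole x y -> ole y z -> ole x z
| ole_succ x y : ole x y -> ole (OS x) (OS y)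
| ole_cocone x f k : ole x (f k) -> ole x (OL f)
| ole_limiting f x : (forall k, ole (f k) x) -> ole (OL f) x.

Definition olt (a b : ord) : Prop := ole (OS a) b.

(* val_le p a  <->  p has a (defined) game value and that value is <= a *)
Inductive val_le : position -> ord -> Prop :=
| vl_won p a : won_open p -> val_le p a
| vl_open p q b a :
    pturn p = Red -> move p q -> val_le q b -> olt b a -> val_le p a
| vl_closed p a :
    pturn p = Black -> ~ won_open p ->
    (forall q, move p q -> val_le q a) -> val_le p a.

Definition has_value (p : position) (a : ord) : Prop :=
  val_le p a /\ forall b, olt b a -> ~ val_le p b.

(* Main.v *)
(** A single black pawn, the runner, is the only black piece that can ever
    move, and it moves by jumping over red pawns along a planar binary tree of
    wires. Stopping on a wire is punished by an immediate capture, after which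
    Black has no move, except on certain stop squares. There the runner
    threatens to step aside and free a black king for ever, and the only useful
    reply of Red is to fill the square next to the runner. So Black walks down
    a well-founded tree of stop squares, paying one turn for each.

    The tree is read off the Brouwer ordinal [a]: a node labelled [OL f] splits
    without a stop into nodes labelled [f 0] and [OL (fun n => f (S n))], and a
    node labelled [OS x] leads through a stop to a node labelled [x]. As the
    runner can always give itself up, a node labelled [x] has value [max 1 x];
    hence the stop below [OS x] is only installed when [1 <= x], and the value 0
    is realised separately by the empty board.

    Black plays along the tree for the lower bound, and Red captures or fills
    for the upper bound. *)

From Stdlib Require Import ZArith List Lia Bool ClassicalEpsilon.
Require Import Defs.
Import ListNotations.
Open Scope Z_scope.

(** The two bounds need different control of Red. For the upper bound Red's replies are chosen, all
    of them on the wires, so the rest of the board stays exactly as it was set up. For the lower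
    bound every reply on an infinite board must be met, and two facts keep this finite. A trip from
    one stop to any later one is a single iterated jump, so Red makes only one move between the
    stops at which Black rests, and the board ahead is still untouched when the runner gets there.
    And once that move fails to defuse the threat, only finitely many squares matter: a region
    walled by black pawns that protect each other, where the king can step back and forth for ever,
    so that the position has no value. Such regions are finite patterns, whose stability under all
    red moves is decided by computation. As there is no promotion and no red king is placed, red
    pieces move in two directions only. The wires must not cross, since the runner could change
    wires at a crossing; this dictates the choice of [height]. *)

Ltac Zify.zify_post_hook ::= Z.to_euclidean_division_equations.

(** * Comparison of Brouwer ordinals *)

Fixpoint ole_code (x : ord) : ord -> Prop :=
  match x with
  | OZ => fun _ => True
  | OS x' => fix lt (y : ord) : Prop :=
      match y with
      | OZ => False
      | OS y' => ole_code x' y'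
      | OL f => exists k, lt (f k)
      end
  | OL f => fun y => forall k, ole_code (f k) y
  end.

Lemma ole_code_cocone x f k : ole_code x (f k) -> ole_code x (OL f).
Proof.
  induction x as [|x _|g IH]; simpl; auto.
  intros H; exists k; exact H.
Qed.

Lemma ole_code_refl x : ole_code x x.
Proof.
  induction x as [|x IH|f IH]; simpl; auto.
  intros k; apply ole_code_cocone with k, IH.
Qed.

Lemma ole_code_trans x y z : ole_code x y -> ole_code y z -> ole_code x z.
Proof.
  revert y z; induction x as [|x IHx|f IHf]; intros y z.
  - simpl; auto.
  - revert z; induction y as [|y _|g IHg]; intros z Hxy.
    + destruct Hxy.
    + induction z as [|z _|h IHh]; intros Hyz.
      * exact Hyz.
      * exact (IHx _ _ Hxy Hyz).
      * destruct Hyz as [k Hk]; exists k; exact (IHh k Hk).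
    + intros Hyz; destruct Hxy as [k Hk]; exact (IHg k z Hk (Hyz k)).
  - intros Hxy Hyz k; exact (IHf k _ _ (Hxy k) Hyz).
Qed.

(* [ole] has transitivity as a constructor, so it can only be inverted
   through this recursive characterisation. *)
Lemma ole_iff_code x y : ole x y <-> ole_code x y.
Proof.
  split.
  - induction 1.
    + exact I.
    + eapply ole_code_trans; eassumption.
    + assumption.
    + eapply ole_code_cocone; eassumption.
    + simpl; assumption.
  - revert y; induction x as [|x IHx|f IHf]; intros y H.
    + apply ole_zero.
    + induction y as [|y _|g IHg].
      * destruct H.
      * apply ole_succ, IHx, H.
      * destruct H as [k Hk]; apply ole_cocone with k, IHg, Hk.
    + apply ole_limiting; intros k; apply IHf, H.
Qed.

Lemma ole_refl x : ole x x.
Proof. apply ole_iff_code, ole_code_refl. Qed.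

Lemma ole_OS_self x : ole x (OS x).
Proof.
  induction x as [|x IH|f IH].
  - apply ole_zero.
  - apply ole_succ, IH.
  - apply ole_limiting; intros k.
    apply ole_trans with (OS (f k)); [apply IH|].
    apply ole_succ, ole_cocone with k, ole_refl.
Qed.

Lemma not_ole_OS_self x : ~ ole (OS x) x.
Proof.
  induction x as [|x IH|f IH]; intros H; apply ole_iff_code in H.
  - exact H.
  - apply IH, ole_iff_code, H.
  - destruct H as [k Hk].
    apply (IH k), ole_trans with (OS (OL f)).
    + apply ole_succ, ole_cocone with k, ole_refl.
    + apply ole_iff_code, Hk.
Qed.

Lemma olt_wf : well_founded olt.
Proof.
  (* Accessibility is shown for everything strictly below a tree [o], so that the induction on [o]
     can pass through limits. *)
  assert (H : forall o x, ole (OS x) o -> Acc olt x).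
  { induction o as [|o IH|f IH]; intros x Hx; apply ole_iff_code in Hx.
    - destruct Hx.
    - constructor; intros y Hy; apply IH.
      apply ole_trans with x; [exact Hy|apply ole_iff_code, Hx].
    - destruct Hx as [k Hk]; apply (IH k), ole_iff_code, Hk. }
  intros x; apply (H (OS x)), ole_refl.
Qed.

Lemma ole_one_or_zero x : ~ ole (OS OZ) x -> ole x OZ.
Proof.
  induction x as [|x IH|f IH]; intros H.
  - apply ole_zero.
  - destruct H; apply ole_succ, ole_zero.
  - apply ole_limiting; intros k; apply IH; intros Hk.
    apply H, ole_cocone with k, Hk.
Qed.

(** * Patterns stable under red moves *)

Definition bpawn := Piece Black Pawn.
Definition bking := Piece Black King.
Definition rpawn := Piece Red Pawn.

Lemma sq_eqb_spec x y : reflect (x = y) (sq_eqb x y).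
Proof.
  destruct x as [a b], y as [c d]; unfold sq_eqb; simpl.
  destruct (Z.eqb_spec a c), (Z.eqb_spec b d); simpl; constructor; congruence.
Qed.

Lemma update_eq b s v : update b s v s = v.
Proof. unfold update; destruct (sq_eqb_spec s s); congruence. Qed.

Lemma update_neq b s v x : x <> s -> update b s v x = b x.
Proof. unfold update; destruct (sq_eqb_spec x s); congruence. Qed.

Definition only_red_pawns (b : board) : Prop :=
  forall s pc, b s = Some pc -> pcolor pc = Red -> pc = rpawn.

Lemma only_red_pawns_none b s : only_red_pawns b -> only_red_pawns (update b s None).
Proof.
  intros H x pc; destruct (sq_eqb_spec x s) as [->|N].
  - rewrite update_eq; discriminate.
  - rewrite update_neq by assumption; apply H.
Qed.

Lemma only_red_pawns_some b s t pc :
  only_red_pawns b -> b t = Some pc -> forall c,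
  only_red_pawns c -> only_red_pawns (update c s (Some pc)).
Proof.
  intros H Ht c Hc x pc'; destruct (sq_eqb_spec x s) as [->|N].
  - rewrite update_eq; intros [= <-]; eauto.
  - rewrite update_neq by assumption; apply Hc.
Qed.

Lemma jump_step_only_red_pawns pc b s b' s' :
  jump_step pc b s b' s' -> only_red_pawns b -> only_red_pawns b'.
Proof.
  intros (dx & dy & _ & Hs & _ & _ & _ & ->) H.
  apply only_red_pawns_some with b s; auto using only_red_pawns_none.
Qed.

Lemma simple_move_only_red_pawns c b b' :
  simple_move b c b' -> only_red_pawns b -> only_red_pawns b'.
Proof.
  intros (s & pc & dx & dy & Hs & _ & _ & _ & ->) H.
  apply only_red_pawns_some with b s; auto using only_red_pawns_none.
Qed.

Lemma jchain_only_red_pawns pc b s b' s' :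
  jchain pc b s b' s' -> only_red_pawns b -> only_red_pawns b'.
Proof. induction 1; eauto using jump_step_only_red_pawns. Qed.

Lemma midpoint_shift s dx dy : midpoint s (shift s 2 dx dy) = shift s 1 dx dy.
Proof.
  destruct s as [x y]; unfold midpoint, shift; cbn [fst snd].
  f_equal; [replace (x + (x + 2 * dx)) with ((x + 1 * dx) * 2) by ring
           |replace (y + (y + 2 * dy)) with ((y + 1 * dy) * 2) by ring];
  apply Z.div_mul; lia.
Qed.

Lemma inf_jump_only_red_pawns pc b s b' :
  inf_jump pc b s b' -> only_red_pawns b -> only_red_pawns b'.
Proof.
  intros (ss & bs & _ & <- & _ & Hb') H x pc' Hx.
  destruct (Hb' x) as [Hyes Hno].
  destruct (classic (exists n, x = ss n \/ x = midpoint (ss n) (ss (S n)))) as [T|T].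
  - rewrite (Hyes T) in Hx; discriminate.
  - rewrite (Hno T) in Hx; eauto.
Qed.

Lemma red_jump_step b s b' s' :
  only_red_pawns b -> (exists pc, pcolor pc = Red /\ jump_step pc b s b' s') ->
  exists dx, (dx = 1 \/ dx = -1) /\ b s = Some rpawn /\
    (exists e, b (shift s 1 dx (-1)) = Some e /\ pcolor e = Black) /\
    b (shift s 2 dx (-1)) = None /\ s' = shift s 2 dx (-1) /\
    b' = update (update (update b s None) (shift s 1 dx (-1)) None) s' (Some rpawn).
Proof.
  intros H (pc & Hc & dx & dy & [Hdx Hdy] & Hs & (e & He & Hec) & Hl & -> & ->).
  assert (pc = rpawn) as -> by eauto.
  simpl in Hdy; subst dy; exists dx; repeat split; auto.
  exists e; split; auto; simpl in Hec; destruct (pcolor e); congruence.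
Qed.

(** [NotBlack] survives every red move. [NotRed] survives captures, which empty black squares, as
    long as no red pawn can enter. *)
Inductive content := Is (o : option piece) | NotBlack | NotRed.

Definition sat (c : content) (o : option piece) : Prop :=
  match c with
  | Is o' => o = o'
  | NotBlack => forall pc, o = Some pc -> pcolor pc = Red
  | NotRed => forall pc, o = Some pc -> pcolor pc = Black
  end.

(* A list of squares, relative to an origin, with what is known of them. *)
Definition pattern := list (square * content).

Definition off (o q : square) : square := (fst o + fst q, snd o + snd q).

Definition matches (o : square) (l : pattern) (b : board) : Prop :=
  forall q c, In (q, c) l -> sat c (b (off o q)).

Definition lookup (l : pattern) (q : square) : option content :=
  option_map snd (find (fun e => sq_eqb (fst e) q) l).

Definition not_red (l : pattern) (q : square) : bool :=
  match lookup l q with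
  | Some NotRed | Some (Is None) | Some (Is (Some (Piece Black _))) => true
  | _ => false
  end.

Definition not_black (l : pattern) (q : square) : bool :=
  match lookup l q with
  | Some NotBlack | Some (Is None) | Some (Is (Some (Piece Red _))) => true
  | _ => false
  end.

Definition occupied (l : pattern) (q : square) : bool :=
  match lookup l q with Some (Is (Some _)) => true | _ => false end.

Definition member (q : square) (l : list square) : bool :=
  existsb (sq_eqb q) l.

(** The cases exclude in turn that a red jump lands on the square, captures the black piece on it,
    or starts from it. One guard among the other two squares of the jump suffices. Guards are read
    in the same pattern, so that they persist through an iterated jump. *)
Definition jump_safe_dir (l : pattern) (e : square * content) (dx : Z) : bool :=
  let q := fst e in
  match snd e with
  | NotBlack => true
  | NotRed | Is None =>
      not_black l (off q (- dx, 1)) || not_red l (off q (- (2 * dx), 2))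
  | Is (Some (Piece Black _)) =>
      not_red l (off q (- dx, 1)) || occupied l (off q (dx, -1))
  | Is (Some (Piece Red _)) =>
      not_black l (off q (dx, -1)) || occupied l (off q (2 * dx, -2))
  end.

Definition jump_safe (l : pattern) : bool :=
  forallb (fun e => jump_safe_dir l e 1 && jump_safe_dir l e (-1)) l.

(** A simple move is the whole turn, so the guards in [pre] need not survive it. Moves starting from
    the squares in [excl] are left to be treated by hand. *)
Definition simple_safe_dir (excl : list square) (pre : pattern)
    (e : square * content) (dx : Z) : bool :=
  let q := fst e in
  match snd e with
  | NotBlack => true
  | NotRed | Is None =>
      not_red pre (off q (- dx, 1)) || member (off q (- dx, 1)) excl
  | Is (Some (Piece Black _)) => true
  | Is (Some (Piece Red _)) => member q excl || occupied pre (off q (dx, -1))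
  end.

Definition simple_safe (excl : list square) (pre l : pattern) : bool :=
  forallb (fun e => simple_safe_dir excl pre e 1 && simple_safe_dir excl pre e (-1)) l.

Definition content_implies (c d : content) : bool :=
  match c, d with
  | Is None, Is None | NotBlack, NotBlack | NotRed, NotRed => true
  | Is (Some (Piece Black Pawn)), Is (Some (Piece Black Pawn))
  | Is (Some (Piece Black King)), Is (Some (Piece Black King))
  | Is (Some (Piece Red Pawn)), Is (Some (Piece Red Pawn))
  | Is (Some (Piece Red King)), Is (Some (Piece Red King)) => true
  | Is (Some (Piece Black _)), NotRed | Is None, NotRed
  | Is (Some (Piece Red _)), NotBlack | Is None, NotBlack => true
  | _, _ => false
  end.

Definition weaker (l' l : pattern) : bool :=
  forallb (fun e => match lookup l (fst e) with
                    | Some c => content_implies c (snd e) | None => false end) l'.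

Definition set_square (q : square) (v : option piece) (l : pattern) : pattern :=
  (q, Is v) :: filter (fun e => negb (sq_eqb (fst e) q)) l.

Lemma lookup_sound o l b q c :
  matches o l b -> lookup l q = Some c -> sat c (b (off o q)).
Proof.
  unfold lookup; intros H.
  destruct (find _ l) as [[q' c']|] eqn:E; [|discriminate].
  apply find_some in E as [Hin Hq]; simpl in Hq; intros [= <-].
  destruct (sq_eqb_spec q' q); [subst; auto|discriminate].
Qed.

Lemma not_red_sound o l b q pc :
  matches o l b -> not_red l q = true -> b (off o q) = Some pc -> pcolor pc = Black.
Proof.
  unfold not_red; intros H; destruct (lookup l q) as [c|] eqn:E; [|discriminate].
  pose proof (lookup_sound _ _ _ _ _ H E) as S.
  destruct c as [[[[|] k]|]| |]; simpl in S; intros; try discriminate; auto;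
  rewrite S in *; try discriminate.
  injection H1 as <-; reflexivity.
Qed.

Lemma not_black_sound o l b q pc :
  matches o l b -> not_black l q = true -> b (off o q) = Some pc -> pcolor pc = Red.
Proof.
  unfold not_black; intros H; destruct (lookup l q) as [c|] eqn:E; [|discriminate].
  pose proof (lookup_sound _ _ _ _ _ H E) as S.
  destruct c as [[[[|] k]|]| |]; simpl in S; intros; try discriminate; auto;
  rewrite S in *; try discriminate.
  injection H1 as <-; reflexivity.
Qed.

Lemma occupied_sound o l b q :
  matches o l b -> occupied l q = true -> b (off o q) <> None.
Proof.
  unfold occupied; intros H; destruct (lookup l q) as [c|] eqn:E; [|discriminate].
  pose proof (lookup_sound _ _ _ _ _ H E) as S.
  destruct c as [[p|]| |]; simpl in S; intros; congruence.
Qed.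

Lemma weaker_sound o l l' b : weaker l' l = true -> matches o l b -> matches o l' b.
Proof.
  unfold weaker; intros H M q c Hin.
  rewrite forallb_forall in H; specialize (H _ Hin); simpl in H.
  destruct (lookup l q) as [d|] eqn:E; [|discriminate].
  pose proof (lookup_sound _ _ _ _ _ M E) as S.
  destruct d as [[[[|] [|]]|]| |], c as [[[[|] [|]]|]| |]; try discriminate;
  simpl in *; auto; rewrite S; intros ? [=]; subst; reflexivity.
Qed.

Lemma off_inj o q q' : off o q = off o q' -> q = q'.
Proof. destruct q, q'; unfold off; simpl; intros [=]; f_equal; lia. Qed.

Lemma off_off o q r : off (off o q) r = off o (off q r).
Proof. unfold off; cbn [fst snd]; f_equal; lia. Qed.

Lemma set_square_sound o l b q v :
  matches o l b -> matches o (set_square q v l) (update b (off o q) v).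
Proof.
  intros M q' c [[= <- <-]|Hin].
  - apply update_eq.
  - apply filter_In in Hin as [Hin Hq]; simpl in Hq.
    destruct (sq_eqb_spec q' q) as [|N]; [discriminate|].
    rewrite update_neq; [auto|].
    intros E; apply N, off_inj with o, E.
Qed.

(** The second conclusion serves infinite jumps, which clear every square they touch: clearing only
    harms an entry that demands a piece. *)
Lemma jump_safe_sound o l b s b' s' :
  jump_safe l = true -> matches o l b -> only_red_pawns b ->
  (exists pc, pcolor pc = Red /\ jump_step pc b s b' s') ->
  matches o l b' /\
  forall q c, In (q, Is (Some c)) l -> off o q <> s /\ off o q <> midpoint s s'.
Proof.
  intros J M R Hj.
  destruct (red_jump_step _ _ _ _ R Hj) as (dx & Hdx & Hs & (e & He & Hec) & Hl & -> & ->).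
  rewrite midpoint_shift.
  assert (J' : forall q c, In (q, c) l -> jump_safe_dir l (q, c) dx = true).
  { intros q c Hin; unfold jump_safe in J; rewrite forallb_forall in J.
    specialize (J _ Hin); apply andb_prop in J; destruct Hdx as [-> | ->]; tauto. }
  assert (Hent : forall q c, In (q, c) l -> c = NotRed \/ c = Is None ->
            off o q <> shift s 2 dx (-1)).
  { intros q c Hin Hc E; specialize (J' _ _ Hin); unfold jump_safe_dir in J'; simpl in J'.
    assert (Hs' : s = off o (off q (- (2 * dx), 2))).
    { rewrite <- off_off, E; destruct s; unfold off, shift; cbn [fst snd]; f_equal; lia. }
    assert (Hm : shift s 1 dx (-1) = off o (off q (- dx, 1))).
    { rewrite <- off_off, E; destruct s; unfold off, shift; cbn [fst snd]; f_equal; lia. }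
    assert (Hor : not_black l (off q (- dx, 1)) = true
                  \/ not_red l (off q (- (2 * dx), 2)) = true).
    { apply orb_prop; destruct Hc as [-> | ->]; exact J'. }
    destruct Hor as [H|H].
    - rewrite Hm in He.
      pose proof (not_black_sound _ _ _ _ _ M H He); congruence.
    - rewrite Hs' in Hs.
      pose proof (not_red_sound _ _ _ _ _ M H Hs); discriminate. }
  assert (Huntouched : forall q c, In (q, Is (Some c)) l ->
            off o q <> s /\ off o q <> shift s 1 dx (-1)).
  { intros q c Hin; pose proof (M _ _ Hin) as Hq; simpl in Hq.
    specialize (J' _ _ Hin); unfold jump_safe_dir in J'; simpl in J'.
    split; intros E.
    - rewrite E, Hs in Hq; injection Hq as <-; simpl in J'.
      assert (Hm : shift s 1 dx (-1) = off o (off q (dx, -1))).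
      { rewrite <- off_off, E; destruct s; unfold off, shift; cbn [fst snd]; f_equal; lia. }
      assert (Hm2 : shift s 2 dx (-1) = off o (off q (2 * dx, -2))).
      { rewrite <- off_off, E; destruct s; unfold off, shift; cbn [fst snd]; f_equal; lia. }
      apply orb_prop in J' as [H|H].
      + rewrite Hm in He.
        pose proof (not_black_sound _ _ _ _ _ M H He); congruence.
      + rewrite Hm2 in Hl; exact (occupied_sound _ _ _ _ M H Hl).
    - rewrite E, He in Hq; injection Hq as <-.
      destruct e as [[|] k]; [|discriminate]; simpl in J'.
      assert (Hm : s = off o (off q (- dx, 1))).
      { rewrite <- off_off, E; destruct s; unfold off, shift; cbn [fst snd]; f_equal; lia. }
      assert (Hm2 : shift s 2 dx (-1) = off o (off q (dx, -1))).
      { rewrite <- off_off, E; destruct s; unfold off, shift; cbn [fst snd]; f_equal; lia. }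
      apply orb_prop in J' as [H|H].
      + rewrite Hm in Hs.
        pose proof (not_red_sound _ _ _ _ _ M H Hs); discriminate.
      + rewrite Hm2 in Hl; exact (occupied_sound _ _ _ _ M H Hl). }
  split; [|exact Huntouched].
  intros q c Hin; pose proof (M _ _ Hin) as Hq.
  destruct (sq_eqb_spec (off o q) (shift s 2 dx (-1))) as [E|N].
  - rewrite E, update_eq; destruct c as [[c|]| |]; simpl in *.
    + rewrite E, Hl in Hq; discriminate.
    + destruct (Hent _ _ Hin); auto.
    + intros pc [= <-]; reflexivity.
    + destruct (Hent _ _ Hin); auto.
  - rewrite update_neq by assumption.
    destruct c as [[c|]| |].
    + destruct (Huntouched _ _ Hin); rewrite !update_neq by assumption; exact Hq.
    + simpl in *; unfold update.
      destruct (sq_eqb _ _); [reflexivity|].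
      destruct (sq_eqb _ _); auto.
    + simpl in *; unfold update.
      destruct (sq_eqb _ _); [discriminate|].
      destruct (sq_eqb _ _); [discriminate|auto].
    + simpl in *; unfold update.
      destruct (sq_eqb _ _); [discriminate|].
      destruct (sq_eqb _ _); [discriminate|auto].
Qed.

Lemma simple_safe_sound o excl pre l b s dx :
  simple_safe excl pre l = true -> matches o pre b -> matches o l b ->
  dx = 1 \/ dx = -1 -> b s = Some rpawn -> b (shift s 1 dx (-1)) = None ->
  (forall q, In q excl -> s <> off o q) ->
  matches o l (update (update b s None) (shift s 1 dx (-1)) (Some rpawn)).
Proof.
  intros J P M Hdx Hs Hl Hex q c Hin.
  pose proof (M _ _ Hin) as Hq.
  assert (J' : simple_safe_dir excl pre (q, c) dx = true).
  { unfold simple_safe in J; rewrite forallb_forall in J.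
    specialize (J _ Hin); apply andb_prop in J; destruct Hdx as [-> | ->]; tauto. }
  unfold simple_safe_dir in J'; simpl in J'.
  assert (Hmem : forall r, member r excl = true -> s <> off o r).
  { intros r Hr; apply existsb_exists in Hr as (r' & Hr' & Heq).
    destruct (sq_eqb_spec r r'); [subst; auto|discriminate]. }
  destruct (sq_eqb_spec (off o q) (shift s 1 dx (-1))) as [E|N].
  - rewrite E, update_eq.
    assert (Hs' : s = off o (off q (- dx, 1))).
    { rewrite <- off_off, E; destruct s; unfold off, shift; cbn [fst snd]; f_equal; lia. }
    assert (Hno : (not_red pre (off q (- dx, 1)) || member (off q (- dx, 1)) excl)%bool = true
             -> False).
    { intros H; apply orb_prop in H as [H|H].
      - rewrite Hs' in Hs.
        pose proof (not_red_sound _ _ _ _ _ P H Hs); discriminate.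
      - exact (Hmem _ H Hs'). }
    destruct c as [[c|]| |]; simpl in *.
    + rewrite E, Hl in Hq; discriminate.
    + destruct (Hno J').
    + intros pc [= <-]; reflexivity.
    + destruct (Hno J').
  - rewrite update_neq by assumption.
    destruct (sq_eqb_spec (off o q) s) as [E|N'].
    + rewrite E, update_eq; destruct c as [[[[|] k]|]| |]; simpl in *; try discriminate.
      * rewrite E, Hs in Hq; discriminate.
      * apply orb_prop in J' as [H|H].
        -- destruct (Hmem _ H); auto.
        -- assert (Hm : shift s 1 dx (-1) = off o (off q (dx, -1))).
           { rewrite <- off_off, E; destruct s; unfold off, shift; cbn [fst snd]; f_equal; lia. }
           rewrite Hm in Hl; destruct (occupied_sound _ _ _ _ P H Hl).
      * reflexivity.
    + rewrite update_neq by assumption; exact Hq.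
Qed.

Lemma matches_ext o l b b' : (forall x, b' x = b x) -> matches o l b -> matches o l b'.
Proof. intros E M q c Hin; rewrite E; auto. Qed.

Lemma only_red_pawns_ext b b' :
  (forall x, b' x = b x) -> only_red_pawns b -> only_red_pawns b'.
Proof. intros E M s pc; rewrite E; apply M. Qed.

Lemma move_only_red_pawns p q :
  move p q -> only_red_pawns (pboard p) -> only_red_pawns (pboard q).
Proof.
  intros (_ & b' & E & H) R; apply only_red_pawns_ext with b'; auto.
  destruct H as [H|[(pc & s & s' & _ & H)|(pc & s & _ & H)]];
  eauto using simple_move_only_red_pawns, jchain_only_red_pawns, inf_jump_only_red_pawns.
Qed.

(* [pre] need only hold before the move, [inv] has to survive every single
   jump of an iterated jump. *)
Lemma red_move_matches o excl pre inv post p q :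
  jump_safe inv = true -> simple_safe excl pre post = true ->
  weaker post inv = true ->
  matches o pre (pboard p) -> matches o inv (pboard p) ->
  only_red_pawns (pboard p) -> pturn p = Red -> move p q ->
  matches o post (pboard q) \/
  exists s dx, In s excl /\ (dx = 1 \/ dx = -1) /\
    pboard p (off o s) = Some rpawn /\ pboard p (off o (off s (dx, -1))) = None /\
    forall x, pboard q x =
      update (update (pboard p) (off o s) None) (off o (off s (dx, -1))) (Some rpawn) x.
Proof.
  intros J S W P M R T (_ & b' & E & H); rewrite T in H.
  destruct H as [H|[(pc & s & s' & Hpc & H)|(pc & s & Hpc & H)]].
  - destruct H as (s & pc & dx & dy & Hs & Hpc & [Hdx Hdy] & Hl & ->).
    assert (pc = rpawn) as -> by eauto.
    simpl in Hdy; subst dy.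
    destruct (existsb (fun q => sq_eqb s (off o q)) excl) eqn:X.
    + right; apply existsb_exists in X as (r & Hr & Heq).
      destruct (sq_eqb_spec s (off o r)) as [->|]; [|discriminate].
      exists r, dx.
      replace (off o (off r (dx, -1))) with (shift (off o r) 1 dx (-1))
        by (destruct r; unfold off, shift; cbn [fst snd]; f_equal; lia).
      repeat split; auto.
    + left; apply matches_ext with (1 := E).
      apply simple_safe_sound with (excl := excl) (pre := pre); auto.
      { apply weaker_sound with inv; auto. }
      intros r Hr ->.
      assert (existsb (fun q => sq_eqb (off o r) (off o q)) excl = true); [|congruence].
      apply existsb_exists; exists r; split; auto.
      destruct (sq_eqb_spec (off o r) (off o r)); congruence.
  - left; apply matches_ext with (1 := E); apply weaker_sound with inv; auto.
    clear E P; revert M R; induction H as [b s b' s' H|b s b1 s1 b' s' H _ IH]; intros M R.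
    + eapply jump_safe_sound; eauto.
    + apply IH; [eapply jump_safe_sound; eauto|eapply jump_step_only_red_pawns; eauto].
  - left; apply matches_ext with (1 := E); apply weaker_sound with inv; auto.
    destruct H as (ss & bs & <- & H0 & Hstep & Hb').
    assert (HM : forall n, matches o inv (bs n) /\ only_red_pawns (bs n)).
    { induction n as [|n [IM IR]]; [rewrite H0; auto|split].
      - eapply jump_safe_sound; eauto.
      - eapply jump_step_only_red_pawns; eauto. }
    intros r c Hin; destruct (Hb' (off o r)) as [Hyes Hno].
    destruct (classic (exists n, off o r = ss n \/ off o r = midpoint (ss n) (ss (Datatypes.S n))))
      as [X|X].
    + rewrite (Hyes X); destruct c as [[c|]| |]; simpl; try discriminate; auto.
      destruct X as [n Hn], (HM n) as [IM IR].
      destruct (jump_safe_sound o inv (bs n) (ss n) _ _ J IM IR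
                 (ex_intro _ pc (conj Hpc (Hstep n)))) as [_ Hu].
      destruct (Hu _ _ Hin); tauto.
    + rewrite (Hno X); exact (M _ _ Hin).
Qed.

(** A derivation of [val_le] is well founded, whereas Black can stay in the trap for ever and Red
    cannot leave it. *)
Lemma no_value (Trap : position -> Prop) :
  (forall p, Trap p -> pturn p = Black -> exists q, move p q /\ Trap q) ->
  (forall p q, Trap p -> pturn p = Red -> move p q -> Trap q) ->
  forall p a, val_le p a -> ~ Trap p.
Proof.
  intros HB HR p a V; induction V as [p a [T W]|p q b a T Hm V IH Hlt|p a T W Hq IH];
  intros X.
  - destruct (HB p X T) as (q & Hm & _); exact (W q Hm).
  - exact (IH (HR _ _ X T Hm)).
  - destruct (HB p X T) as (q & Hm & Xq); exact (IH q Hm Xq).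
Qed.

(** * The stop gadget *)

(* Rotated coordinates for the dark squares: black pawns move along [+u] and
   [+v], red pawns along [-u] and [-v]. *)
Definition sq (u v : Z) : square := (u - v, u + v).

Definition range (m n : nat) : list Z := map Z.of_nat (seq m n).

(** No pawn here can be captured: along each diagonal, the square a captor would come from is not
    red or the one it would land on holds another pawn. The pawns on (5,1) and (6,1) keep Red off
    (4,1), from where a king on (3,1) could be captured. The squares (3,2) and (3,3) left out are
    the cell of the king. *)
Definition fortress : list (Z * Z) :=
  [(5, 1); (6, 1)] ++
  filter (fun e => negb ((fst e =? 3) && ((snd e =? 2) || (snd e =? 3))))
    (list_prod (range 0 7) (range 2 4)).

Definition rel (l : list (Z * Z * content)) : pattern :=
  map (fun e => (sq (fst (fst e)) (snd (fst e)), snd e)) l.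

Definition fortress_pattern : pattern :=
  rel (map (fun e => (e, Is (Some bpawn))) fortress).

(* The stop gadget around the square (0,0) where the runner has just landed
   from below. The runner threatens (0,1), and then to jump over (1,1) and
   (3,1), which frees the king on (3,3). *)
Definition gadget : list (Z * Z * content) :=
  [(0, 0, Is (Some bpawn)); (0, 1, Is None); (1, 1, Is (Some rpawn));
   (2, 1, Is None); (3, 1, Is (Some rpawn)); (4, 1, Is None);
   (3, 2, Is (Some rpawn)); (3, 3, Is (Some bking));
   (-1, 0, Is (Some rpawn)); (-1, 1, Is (Some rpawn)); (1, 0, Is (Some rpawn))].

(** The squares outside the gadget that its red pawns would step on or jump over. While red they
    block simple moves; later [NotBlack] is enough to exclude jumps. The pawns to be kept in place
    include (-1,0) and (-1,1), where a captor of the runner on (0,0) or (0,1) would land. *)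
Definition surroundings (c : content) : list (Z * Z * content) :=
  [(-2, 0, c); (-2, 1, c); (-1, -1, c); (1, -1, c); (3, 0, c)].

Definition armed_cells : list (Z * Z * content) :=
  gadget ++ surroundings (Is (Some rpawn)) ++ map (fun e => (e, Is (Some bpawn))) fortress.

Definition armed : pattern := rel armed_cells.

Definition threat : pattern :=
  rel (gadget ++ surroundings NotBlack) ++ fortress_pattern.

Definition attack : pattern :=
  set_square (sq 0 1) (Some bpawn) (set_square (sq 0 0) None threat).

Definition attack' : pattern :=
  rel [(0, 1, Is (Some bpawn)); (1, 1, Is (Some rpawn)); (2, 1, Is None);
       (3, 1, Is (Some rpawn)); (4, 1, Is None);
       (3, 2, Is (Some rpawn)); (3, 3, Is (Some bking))] ++ fortress_pattern.

(** Covers both ways in which (3,1) gets empty: the runner captures there and rests on (4,1), or Red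
    moves the pawn away and (4,1) stays empty. *)
Definition breach : pattern :=
  rel [(3, 1, Is None); (4, 1, NotRed); (3, 2, Is (Some rpawn));
       (3, 3, Is (Some bking))] ++ fortress_pattern.

Definition king_out : pattern :=
  rel [(3, 1, Is (Some bking)); (4, 1, NotRed); (3, 2, Is None); (3, 3, Is None)]
  ++ fortress_pattern.

Definition king_low : pattern :=
  rel [(3, 2, Is (Some bking)); (3, 3, Is None)] ++ fortress_pattern.

Definition king_high : pattern :=
  rel [(3, 2, Is None); (3, 3, Is (Some bking))] ++ fortress_pattern.

Lemma shift_off o q k dx dy : shift (off o q) k dx dy = off o (off q (k * dx, k * dy)).
Proof. destruct q; unfold off, shift; cbn [fst snd]; f_equal; lia. Qed.

Lemma pattern_simple_move o l b q pc dx dy :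
  matches o l b -> lookup l q = Some (Is (Some pc)) -> allowed_dir pc dx dy ->
  lookup l (off q (1 * dx, 1 * dy)) = Some (Is None) ->
  exists b', simple_move b (pcolor pc) b' /\
    matches o (set_square (off q (1 * dx, 1 * dy)) (Some pc) (set_square q None l)) b'.
Proof.
  intros M Hq Hd Hl.
  pose proof (lookup_sound _ _ _ _ _ M Hq) as Hb.
  pose proof (lookup_sound _ _ _ _ _ M Hl) as Hb'.
  eexists; split.
  - exists (off o q), pc, dx, dy; repeat split; try apply Hd; auto.
    rewrite shift_off; exact Hb'.
  - rewrite shift_off; apply set_square_sound, set_square_sound, M.
Qed.

Lemma pattern_jump_step o l b q pc dx dy e :
  matches o l b -> lookup l q = Some (Is (Some pc)) -> allowed_dir pc dx dy ->
  lookup l (off q (1 * dx, 1 * dy)) = Some (Is (Some e)) -> pcolor e <> pcolor pc ->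
  lookup l (off q (2 * dx, 2 * dy)) = Some (Is None) ->
  exists b', jump_step pc b (off o q) b' (off o (off q (2 * dx, 2 * dy))) /\
    matches o (set_square (off q (2 * dx, 2 * dy)) (Some pc)
                (set_square (off q (1 * dx, 1 * dy)) None (set_square q None l))) b'.
Proof.
  intros M Hq Hd He Hc Hl.
  pose proof (lookup_sound _ _ _ _ _ M Hq) as Hb.
  pose proof (lookup_sound _ _ _ _ _ M He) as Hbe.
  pose proof (lookup_sound _ _ _ _ _ M Hl) as Hb'.
  eexists; split.
  - exists dx, dy; rewrite !shift_off; repeat split; try apply Hd; eauto.
  - apply set_square_sound, set_square_sound, set_square_sound, M.
Qed.

(** Indexed by the player to move. The play ends up alternating between [king_low] and
    [king_high]. *)
Definition traps (c : color) : list pattern :=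
  match c with
  | Black => [threat; attack'; breach; king_out; king_low; king_high]
  | Red => [attack; breach; king_out; king_low; king_high]
  end.

Definition trapped (o : square) (p : position) : Prop :=
  only_red_pawns (pboard p) /\
  exists l, In l (traps (pturn p)) /\ matches o l (pboard p).

Lemma trapped_move o p b' l :
  pturn p = Black -> only_red_pawns (pboard p) ->
  (simple_move (pboard p) Black b' \/
   exists pc s s', pcolor pc = Black /\ jchain pc (pboard p) s b' s') ->
  matches o l b' -> (exists l', In l' (traps Red) /\ weaker l' l = true) ->
  exists q, move p q /\ trapped o q.
Proof.
  intros T R H M (l' & Hin & W).
  assert (Hm : move p (Pos b' Red)).
  { split; [rewrite T; reflexivity|]; exists b'; split; [reflexivity|].
    rewrite T; tauto. }
  exists (Pos b' Red); split; [exact Hm|split].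
  - exact (move_only_red_pawns _ _ Hm R).
  - exists l'; split; [exact Hin|exact (weaker_sound _ _ _ _ W M)].
Qed.

Lemma trapped_king_move o p l q dx dy l' :
  pturn p = Black -> only_red_pawns (pboard p) -> matches o l (pboard p) ->
  lookup l q = Some (Is (Some bking)) -> allowed_dir bking dx dy ->
  lookup l (off q (1 * dx, 1 * dy)) = Some (Is None) -> In l' (traps Red) ->
  weaker l' (set_square (off q (1 * dx, 1 * dy)) (Some bking) (set_square q None l)) = true ->
  exists r, move p r /\ trapped o r.
Proof.
  intros T R M Hq Hd Hl Hin W.
  destruct (pattern_simple_move _ _ _ _ _ _ _ M Hq Hd Hl) as (b' & Hm & M').
  eapply trapped_move; eauto.
Qed.

Ltac in_list :=
  cbn [In traps];
  lazymatch goal with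
  | |- ?x = ?y \/ _ => tryif constr_eq x y then left; reflexivity else (right; in_list)
  end.

Ltac dir := split; [lia|simpl; auto].

Lemma trapped_black o p :
  trapped o p -> pturn p = Black -> exists q, move p q /\ trapped o q.
Proof.
  intros (R & l & Hin & M) T; rewrite T in Hin; simpl in Hin.
  destruct Hin as [<-|[<-|[<-|[<-|[<-|[<-|[]]]]]]].
  - destruct (pattern_simple_move o threat (pboard p) (sq 0 0) bpawn (-1) 1)
      as (b' & Hm & M'); try reflexivity; [assumption|dir|].
    eapply trapped_move; eauto; exists attack; split; [in_list|reflexivity].
  - destruct (pattern_jump_step o attack' (pboard p) (sq 0 1) bpawn 1 1 rpawn)
      as (b1 & H1 & M1); try reflexivity; [assumption|dir|discriminate|].
    edestruct (fun l => pattern_jump_step o l b1 (sq 2 1) bpawn 1 1 rpawn)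
      as (b2 & H2 & M2); try exact M1; try reflexivity; [dir|discriminate|].
    eapply trapped_move; eauto.
    + right; exists bpawn; do 2 eexists; split; [reflexivity|].
      eapply jc_more; [exact H1|]; apply jc_one; exact H2.
    + exists breach; split; [in_list|vm_compute; reflexivity].
  - destruct (pattern_jump_step o breach (pboard p) (sq 3 3) bking 1 (-1) rpawn)
      as (b1 & H1 & M1); try reflexivity; [assumption|dir|discriminate|].
    eapply trapped_move; eauto.
    + right; exists bking; do 2 eexists; split; [reflexivity|].
      apply jc_one; exact H1.
    + exists king_out; split; [in_list|reflexivity].
  - apply trapped_king_move with king_out (sq 3 1) (-1) 1 king_low;
      try assumption; try reflexivity; [dir|in_list].
  - apply trapped_king_move with king_low (sq 3 2) (-1) 1 king_high;
      try assumption; try reflexivity; [dir|in_list].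
  - apply trapped_king_move with king_high (sq 3 3) 1 (-1) king_low;
      try assumption; try reflexivity; [dir|in_list].
Qed.

Lemma trapped_stable o p q l :
  only_red_pawns (pboard p) -> matches o l (pboard p) -> pturn p = Red ->
  move p q -> jump_safe l = true -> simple_safe [] l l = true -> weaker l l = true ->
  In l (traps Black) -> trapped o q.
Proof.
  intros R M T Hm J S W Hin; split; [exact (move_only_red_pawns _ _ Hm R)|].
  exists l; destruct Hm as [T' Hm'] eqn:E; rewrite T', T; split; [exact Hin|].
  destruct (red_move_matches o [] l l l p q) as [H|(s & _ & [] & _)]; auto.
Qed.

Lemma update2_matches o l b s t v w :
  matches o l b ->
  matches o (set_square t w (set_square s v l)) (update (update b (off o s) v) (off o t) w).
Proof. intros M; apply set_square_sound, set_square_sound, M. Qed.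

Lemma trapped_red o p q : trapped o p -> pturn p = Red -> move p q -> trapped o q.
Proof.
  intros (R & l & Hin & M) T Hm.
  pose proof (move_only_red_pawns _ _ Hm R) as R'.
  assert (T' : pturn q = Black) by (destruct Hm as [-> _]; rewrite T; reflexivity).
  rewrite T in Hin; simpl in Hin.
  destruct Hin as [<-|[<-|[<-|[<-|[<-|[]]]]]].
  - split; [exact R'|rewrite T'].
    destruct (red_move_matches o [sq 3 1] attack attack attack' p q)
      as [H|(s & dx & [<-|[]] & Hdx & Hs & Hl & E)];
      try assumption; try reflexivity.
    + exists attack'; split; [in_list|exact H].
    (* The pawn on (3,1) has stepped away by itself, which opens the way of the king without a
       capture. *)
    + exists breach; split; [in_list|].
      apply matches_ext with (1 := E).
      eapply weaker_sound; [|apply update2_matches, M].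
      destruct Hdx as [-> | ->]; reflexivity.
  - split; [exact R'|rewrite T'].
    destruct (red_move_matches o [sq 3 2] breach breach breach p q)
      as [H|(s & dx & [<-|[]] & Hdx & Hs & Hl & E)];
      try assumption; try reflexivity.
    + exists breach; split; [in_list|exact H].
    (* Red can plug (3,1) only with the pawn from (3,2), which vacates a square of the king's cell.
       The other diagonal leads to (2,2), a pawn of the fortress. *)
    + exists king_high; split; [in_list|].
      apply matches_ext with (1 := E).
      eapply weaker_sound; [|apply update2_matches, M].
      destruct Hdx as [-> | ->]; [reflexivity|].
      exfalso; eapply occupied_sound with (1 := M); [|exact Hl]; reflexivity.
  - apply (trapped_stable o p q _ R M T Hm); try reflexivity; in_list.
  - apply (trapped_stable o p q _ R M T Hm); try reflexivity; in_list.
  - apply (trapped_stable o p q _ R M T Hm); try reflexivity; in_list.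
Qed.

Lemma threat_no_value o p a :
  pturn p = Black -> only_red_pawns (pboard p) -> matches o threat (pboard p) ->
  ~ val_le p a.
Proof.
  intros T R M V; apply (no_value (trapped o)) with (3 := V).
  - apply trapped_black.
  - apply trapped_red.
  - split; [exact R|exists threat; rewrite T; split; [in_list|exact M]].
Qed.

(** * The board *)

(* Tiles are 12 by 12, with wires through row 4 and column 4. Wire [w] runs
   to the right in row [height w] of the tiles, from tile column [w/2] to tile
   column [w], which climbs from there and sends out the wires [xI w] and [xO w].
   The heights are chosen so that wires cross no columns. *)
Inductive tile := Wire | Turn | Riser | Fork | Corner | Stop.

Fixpoint height (p : positive) : Z :=
  match p with
  | xH => 0
  | xO q => 2 * height q + 2
  | xI q => 2 * height q + 1
  end.

Definition tile_at (st : positive -> bool) (i k : Z) : tile :=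
  match i with
  | Zpos p =>
      let h := height p in
      if k =? h then Turn
      else if k =? 2 * h + 2 then (if st p then Stop else Corner)
      else if k =? 2 * h + 1 then Fork
      else if (h <? k) && (k <? 2 * h + 1) then Riser
      else Wire
  | _ => Wire
  end.

(** At [Turn] and [Corner] the wire overshoots the bend (4,4) by one square: the red pawn there
    captures a runner resting on the bend. At [Stop] the gadget's (0,0) is (4,4), and the squares
    added in row 5 are those that are empty or from which Red fills. The square (7,5) is left out,
    so that its pawn, which locks the king in, counts as immovable. *)
Definition in_path (t : tile) (a b : Z) : bool :=
  match t with
  | Wire => (b =? 4) || ((a =? 4) && (b =? 5))
  | Turn => ((b =? 4) && (a <=? 5)) || ((a =? 4) && (4 <=? b))
  | Riser => (a =? 4) || ((a =? 5) && (b =? 4))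
  | Fork => (a =? 4) || ((b =? 4) && (4 <=? a))
  | Corner => ((a =? 4) && (b <=? 5)) || ((b =? 4) && (4 <=? a))
  | Stop => ((a =? 4) && (b <=? 5)) || ((b =? 4) && (4 <=? a))
            || ((b =? 5) && ((a =? 5) || (a =? 6) || (a =? 8)))
  end.

Definition path_content (t : tile) (a b : Z) : option piece :=
  if ((a mod 2 =? 0) && (b mod 2 =? 0))
     || match t with Stop => (b =? 5) && (a mod 2 =? 0) | _ => false end
  then None else Some rpawn.

Definition path (st : positive -> bool) (u v : Z) : bool :=
  in_path (tile_at st (u / 12) (v / 12)) (u mod 12) (v mod 12).

(* Filling every square from which a black piece could enter the path, by a
   simple move or by a jump, with a red piece immobilises the black pieces. *)
Definition init (st : positive -> bool) (u v : Z) : option piece :=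
  let t := tile_at st (u / 12) (v / 12) in
  let a := u mod 12 in
  let b := v mod 12 in
  if path st u v then path_content t a b
  else if path st (u + 1) v || path st (u + 2) v
          || path st u (v + 1) || path st u (v + 2) then Some rpawn
  else match t with
       | Stop => if (a =? 7) && (b =? 6) then Some rpawn
                 else if (a =? 7) && (b =? 7) then Some bking else Some bpawn
       | _ => Some bpawn
       end.

Definition start_board (st : positive -> bool) : board := fun s =>
  if sq_eqb s (sq 4 4) then Some bpawn
  else if (fst s + snd s) mod 2 =? 0
  then init st ((fst s + snd s) / 2) ((snd s - fst s) / 2) else None.

(** * Reading the board tile by tile *)

Lemma sq_inj u v u' v' : sq u v = sq u' v' -> u = u' /\ v = v'.
Proof. unfold sq; intros [=]; lia. Qed.

Lemma start_board_sq st u v : (u, v) <> (4, 4) -> start_board st (sq u v) = init st u v.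
Proof.
  intros N; unfold start_board.
  destruct (sq_eqb_spec (sq u v) (sq 4 4)) as [E|_].
  - apply sq_inj in E as [-> ->]; congruence.
  - unfold sq; cbn [fst snd].
    replace (u - v + (u + v)) with (u * 2) by ring.
    replace (u + v - (u - v)) with (v * 2) by ring.
    rewrite Z.mod_mul, !Z.div_mul by lia; reflexivity.
Qed.

Lemma local_div i a : 0 <= a < 12 -> (12 * i + a) / 12 = i.
Proof. lia. Qed.

Lemma local_mod i a : 0 <= a < 12 -> (12 * i + a) mod 12 = a.
Proof. lia. Qed.

Lemma path_local st i k a b : 0 <= a < 12 -> 0 <= b < 12 ->
  path st (12 * i + a) (12 * k + b) = in_path (tile_at st i k) a b.
Proof.
  intros Ha Hb; unfold path.
  rewrite !local_div, !local_mod by assumption; reflexivity.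
Qed.

Lemma init_path st u v : path st u v = true ->
  init st u v = path_content (tile_at st (u / 12) (v / 12)) (u mod 12) (v mod 12).
Proof. unfold init; intros ->; reflexivity. Qed.

Lemma init_none st u v : init st u v = None -> path st u v = true.
Proof.
  unfold init; destruct (path st u v); [reflexivity|].
  destruct (_ || _); [discriminate|].
  destruct (tile_at _ _ _); try discriminate.
  destruct (_ && _); [discriminate|destruct (_ && _); discriminate].
Qed.

Lemma init_red st u v pc : init st u v = Some pc -> pcolor pc = Red -> pc = rpawn.
Proof.
  unfold init, path_content; destruct (path st u v).
  - destruct (_ || _); [discriminate|intros [= <-]; reflexivity].
  - destruct (_ || _); [intros [= <-]; reflexivity|].
    destruct (tile_at _ _ _); try (intros [= <-]; discriminate).
    destruct (_ && _); [intros [= <-]; reflexivity|].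
    destruct (_ && _); intros [= <-]; discriminate.
Qed.

Lemma path_not_black st u v pc :
  path st u v = true -> init st u v = Some pc -> pcolor pc = Red.
Proof.
  intros H; rewrite init_path by assumption; unfold path_content.
  destruct (_ || _); [discriminate|intros [= <-]; reflexivity].
Qed.

(** Upwards, one or two steps from a black piece, there is no path square, by the filling in [init].
    The king also looks downwards; there (7,6), (7,5), (6,7) and (5,7) of its tile lie off the
    path. *)
Lemma init_black st u v pc dx dy k :
  init st u v = Some pc -> pcolor pc = Black -> allowed_dir pc dx dy ->
  k = 1 \/ k = 2 ->
  exists u' v', shift (sq u v) k dx dy = sq u' v' /\ path st u' v' = false.
Proof.
  intros H Hc Hd Hk.
  assert (P : path st u v = false).
  { destruct (path st u v) eqn:E; auto.
    pose proof (path_not_black _ _ _ _ E H); congruence. }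
  assert (S : forall du dv, dx = du - dv -> dy = du + dv ->
            shift (sq u v) k dx dy = sq (u + k * du) (v + k * dv)).
  { intros; subst; unfold shift, sq; cbn [fst snd]; f_equal; ring. }
  unfold init in H; rewrite P in H.
  destruct (_ || _) eqn:E in H; [injection H as <-; discriminate|].
  apply orb_false_elim in E as [E P4]; apply orb_false_elim in E as [E P3].
  apply orb_false_elim in E as [P1 P2].
  destruct Hd as [Hdx Hdy].
  assert (Hup : dy = 1 -> exists u' v', shift (sq u v) k dx dy = sq u' v'
                          /\ path st u' v' = false).
  { intros Hy; destruct Hdx as [-> | ->].
    - rewrite (S 1 0) by lia; do 2 eexists; split; [reflexivity|].
      rewrite Z.mul_0_r, Z.add_0_r, Z.mul_1_r; destruct Hk as [-> | ->]; assumption.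
    - rewrite (S 0 1) by lia; do 2 eexists; split; [reflexivity|].
      rewrite Z.mul_0_r, Z.add_0_r, Z.mul_1_r; destruct Hk as [-> | ->]; assumption. }
  destruct (tile_at st (u / 12) (v / 12)) eqn:Ht;
    try (injection H as <-; simpl in Hdy; auto; fail).
  destruct (_ && _) in H; [injection H as <-; discriminate|].
  destruct ((u mod 12 =? 7) && (v mod 12 =? 7)) eqn:K;
    injection H as <-; simpl in Hdy; [|auto].
  destruct Hdy as [Hy|Hy]; [auto|].
  apply andb_prop in K as [Ku Kv]; apply Z.eqb_eq in Ku, Kv.
  destruct Hdx as [-> | ->].
  - rewrite (S 0 (-1)) by lia; do 2 eexists; split; [reflexivity|].
    replace (u + k * 0) with (12 * (u / 12) + 7) by lia.
    replace (v + k * -1) with (12 * (v / 12) + (7 - k)) by lia.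
    rewrite path_local, Ht by lia; destruct Hk as [-> | ->]; reflexivity.
  - rewrite (S (-1) 0) by lia; do 2 eexists; split; [reflexivity|].
    replace (u + k * -1) with (12 * (u / 12) + (7 - k)) by lia.
    replace (v + k * 0) with (12 * (v / 12) + 7) by lia.
    rewrite path_local, Ht by lia; destruct Hk as [-> | ->]; reflexivity.
Qed.

(** * Planarity of the layout *)

(** Level [n] of the tree, with indices from [2 ^ n] to [2 ^ (n + 1) - 1], receives the heights from
    [2 ^ n - 1] to [2 ^ (n + 1) - 2] in decreasing order. *)
Lemma height_log2 p : height p = 3 * 2 ^ Z.log2 (Zpos p) - 2 - Zpos p.
Proof.
  induction p as [p IH|p IH|]; cbn [height].
  - pose proof (Z.log2_nonneg (Zpos p)).
    rewrite IH, (Pos2Z.inj_xI p), Z.log2_succ_double, Z.pow_succ_r; lia.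
  - pose proof (Z.log2_nonneg (Zpos p)).
    rewrite IH, (Pos2Z.inj_xO p), Z.log2_double, Z.pow_succ_r; lia.
  - reflexivity.
Qed.

Lemma height_nonneg p : 0 <= height p.
Proof. induction p; cbn [height]; lia. Qed.

(** If [p] is on the level of [w], then [p < w] puts column [p] above the wire. Otherwise [p] is one
    level up, its column ends at the height of [xO p], and [w < 2 * p] puts this end below the
    wire. *)
Lemma height_separated p w : Zpos w / 2 < Zpos p < Zpos w ->
  height w < height p \/ 2 * height p + 2 < height w.
Proof.
  intros [H1 H2]; rewrite !height_log2.
  pose proof (Z.log2_spec (Zpos p) ltac:(lia)) as [P1 P2].
  pose proof (Z.log2_spec (Zpos w) ltac:(lia)) as [W1 W2].
  pose proof (Z.log2_nonneg (Zpos p)) as Np.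
  assert (L1 : Z.log2 (Zpos p) <= Z.log2 (Zpos w)) by (apply Z.log2_le_mono; lia).
  assert (L2 : Z.log2 (Zpos w) <= Z.succ (Z.log2 (Zpos p))).
  { rewrite <- Z.log2_double by lia; apply Z.log2_le_mono; lia. }
  assert (Z.log2 (Zpos w) = Z.log2 (Zpos p)
          \/ Z.log2 (Zpos w) = Z.succ (Z.log2 (Zpos p))) as [E|E] by lia.
  - rewrite E; lia.
  - rewrite E, !Z.pow_succ_r by lia; lia.
Qed.

Lemma tile_at_pos st p k : tile_at st (Zpos p) k =
  (let h := height p in
   if k =? h then Turn
   else if k =? 2 * h + 2 then (if st p then Stop else Corner)
   else if k =? 2 * h + 1 then Fork
   else if (h <? k) && (k <? 2 * h + 1) then Riser
   else Wire).
Proof. reflexivity. Qed.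

Lemma tile_turn st p : tile_at st (Zpos p) (height p) = Turn.
Proof. rewrite tile_at_pos; cbv zeta; rewrite Z.eqb_refl; reflexivity. Qed.

Lemma tile_top st p :
  tile_at st (Zpos p) (2 * height p + 2) = if st p then Stop else Corner.
Proof.
  rewrite tile_at_pos; cbv zeta; pose proof (height_nonneg p).
  destruct (Z.eqb_spec (2 * height p + 2) (height p)); [lia|].
  rewrite Z.eqb_refl; reflexivity.
Qed.

Lemma tile_fork st p : tile_at st (Zpos p) (2 * height p + 1) = Fork.
Proof.
  rewrite tile_at_pos; cbv zeta; pose proof (height_nonneg p).
  destruct (Z.eqb_spec (2 * height p + 1) (height p)); [lia|].
  destruct (Z.eqb_spec (2 * height p + 1) (2 * height p + 2)); [lia|].
  rewrite Z.eqb_refl; reflexivity.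
Qed.

Lemma tile_riser st p k :
  height p < k < 2 * height p + 1 -> tile_at st (Zpos p) k = Riser.
Proof.
  intros H; rewrite tile_at_pos; cbv zeta.
  destruct (Z.eqb_spec k (height p)); [lia|].
  destruct (Z.eqb_spec k (2 * height p + 2)); [lia|].
  destruct (Z.eqb_spec k (2 * height p + 1)); [lia|].
  destruct (Z.ltb_spec (height p) k); [|lia].
  destruct (Z.ltb_spec k (2 * height p + 1)); [reflexivity|lia].
Qed.

Lemma tile_wire st p k :
  k < height p \/ 2 * height p + 2 < k -> tile_at st (Zpos p) k = Wire.
Proof.
  intros H; rewrite tile_at_pos; cbv zeta; pose proof (height_nonneg p).
  destruct (Z.eqb_spec k (height p)); [lia|].
  destruct (Z.eqb_spec k (2 * height p + 2)); [lia|].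
  destruct (Z.eqb_spec k (2 * height p + 1)); [lia|].
  destruct (Z.ltb_spec (height p) k); [|reflexivity].
  destruct (Z.ltb_spec k (2 * height p + 1)); [lia|reflexivity].
Qed.

Lemma tile_row st w i : Zpos w / 2 < i < Zpos w -> tile_at st i (height w) = Wire.
Proof.
  destruct i as [|p|p]; [lia| |lia].
  intros H; apply tile_wire.
  destruct (height_separated p w H); lia.
Qed.

Lemma tile_first st w :
  tile_at st (Zpos w / 2) (height w) =
  match w with xH => Wire | xO p => if st p then Stop else Corner | xI p => Fork end.
Proof.
  destruct w as [p|p|]; cbn [height].
  - replace (Zpos p~1 / 2) with (Zpos p) by lia; apply tile_fork.
  - replace (Zpos p~0 / 2) with (Zpos p) by lia; apply tile_top.
  - reflexivity.
Qed.

Lemma row_path st w u :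
  12 * (Zpos w / 2) + 4 <= u <= 12 * Zpos w + 5 -> path st u (12 * height w + 4) = true.
Proof.
  intros H.
  replace u with (12 * (u / 12) + u mod 12) by lia.
  rewrite path_local by lia.
  assert (u / 12 = Zpos w / 2 \/ Zpos w / 2 < u / 12 < Zpos w \/ u / 12 = Zpos w)
    as [E|[E|E]] by lia.
  - rewrite E, tile_first; destruct w as [p|p|]; [|destruct (st p)|];
      cbn [in_path]; lia.
  - rewrite tile_row by assumption; reflexivity.
  - rewrite E, tile_turn; cbn [in_path]; lia.
Qed.

Lemma row_content st w u :
  12 * (Zpos w / 2) + 4 <= u <= 12 * Zpos w + 5 ->
  init st u (12 * height w + 4) = if u mod 2 =? 0 then None else Some rpawn.
Proof.
  intros H; rewrite init_path by (apply row_path; assumption).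
  unfold path_content; replace ((12 * height w + 4) mod 12) with 4 by lia.
  replace ((u mod 12) mod 2) with (u mod 2) by lia.
  destruct (tile_at _ _ _); destruct (u mod 2 =? 0); reflexivity.
Qed.

(** A runner on a row cannot jump upwards before its end. The second hypothesis excludes the first
    square of a wire [xI p], where the column of the fork goes on upwards. *)
Lemma above_row st w u :
  12 * (Zpos w / 2) + 4 <= u < 12 * Zpos w + 4 ->
  (forall p, w = xI p -> 12 * (Zpos w / 2) + 4 < u) ->
  path st u (12 * height w + 4 + 2) = false.
Proof.
  intros H Hodd.
  replace u with (12 * (u / 12) + u mod 12) by lia.
  replace (12 * height w + 4 + 2) with (12 * height w + 6) by lia.
  rewrite path_local by lia.
  assert (u / 12 = Zpos w / 2 \/ Zpos w / 2 < u / 12 < Zpos w \/ u / 12 = Zpos w)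
    as [E|[E|E]] by lia.
  - rewrite E, tile_first; destruct w as [p|p|]; [|destruct (st p)|];
      cbn [in_path]; try specialize (Hodd _ eq_refl); lia.
  - rewrite tile_row by assumption; cbn [in_path]; lia.
  - rewrite E, tile_turn; cbn [in_path]; lia.
Qed.

Lemma column_tile st w k : height w <= k <= 2 * height w + 2 ->
  k = height w /\ tile_at st (Zpos w) k = Turn \/
  tile_at st (Zpos w) k = Riser \/
  k = 2 * height w + 1 /\ tile_at st (Zpos w) k = Fork \/
  k = 2 * height w + 2 /\ tile_at st (Zpos w) k = if st w then Stop else Corner.
Proof.
  intros H; assert (k = height w \/ height w < k < 2 * height w + 1 \/
    k = 2 * height w + 1 \/ k = 2 * height w + 2) as [E|[E|[E|E]]] by lia.
  - subst; rewrite tile_turn; auto.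
  - rewrite tile_riser by assumption; auto.
  - subst; rewrite tile_fork; auto.
  - subst; rewrite tile_top; tauto.
Qed.

Lemma column_path st w v :
  12 * height w + 4 <= v <= 12 * (2 * height w + 2) + 5 ->
  path st (12 * Zpos w + 4) v = true.
Proof.
  intros H; replace v with (12 * (v / 12) + v mod 12) by lia.
  rewrite path_local by lia.
  destruct (column_tile st w (v / 12)) as [[E ->]|[->|[[E ->]|[E ->]]]]; [lia|..];
    [| | |destruct (st w)]; cbn [in_path]; lia.
Qed.

(** The last square of the range is the one above the bend: red at a corner, but empty at a stop,
    where the runner needs it for its threat. *)
Lemma column_content st w v :
  12 * height w + 4 <= v <= 12 * (2 * height w + 2) + 5 ->
  (v = 12 * (2 * height w + 2) + 5 -> st w = false) ->
  init st (12 * Zpos w + 4) v = if v mod 2 =? 0 then None else Some rpawn.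
Proof.
  intros H Hst; rewrite init_path by (apply column_path; assumption).
  unfold path_content; rewrite local_div, local_mod by lia.
  replace ((v mod 12) mod 2) with (v mod 2) by lia.
  destruct (column_tile st w (v / 12)) as [[E ->]|[->|[[E ->]|[E ->]]]]; [lia|..];
    [| | |destruct (st w)]; cbn [andb orb Z.modulo]; rewrite ?orb_false_r;
    try (destruct (v mod 2 =? 0); reflexivity).
  replace (v mod 12 =? 5) with false; [destruct (v mod 2 =? 0); reflexivity|].
  symmetry; apply Z.eqb_neq; intros C.
  assert (true = false); [apply Hst; lia|discriminate].
Qed.

Lemma right_of_column st w v :
  12 * height w + 4 <= v < 12 * (2 * height w + 2) + 4 ->
  path st (12 * Zpos w + 4 + 2) v = true -> v = 12 * (2 * height w + 1) + 4.
Proof.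
  intros H.
  replace (12 * Zpos w + 4 + 2) with (12 * Zpos w + 6) by lia.
  intros P; replace v with (12 * (v / 12) + v mod 12) in P by lia.
  rewrite path_local in P by lia; revert P.
  destruct (column_tile st w (v / 12)) as [[E ->]|[->|[[E ->]|[E ->]]]]; [lia|..];
    [| | |destruct (st w)]; cbn [in_path]; lia.
Qed.

(** * The upper bound *)

(** The binary digits of [p] after the leading one are the turns taken from the root. Branches to
    which the label assigns nothing are dead and carry [OZ]. *)
Fixpoint label (A : ord) (p : positive) : ord :=
  match p with
  | xH => A
  | xO q => match label A q with OZ => OZ | OS x => x | OL f => f O end
  | xI q => match label A q with OL f => OL (fun n => f (S n)) | _ => OZ end
  end.

Definition stops (A : ord) (p : positive) : bool :=
  if excluded_middle_informative (exists x, label A p = OS x /\ ole (OS OZ) x)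
  then true else false.

Lemma stops_true A p : stops A p = true ->
  label A p = OS (label A (xO p)) /\ ole (OS OZ) (label A (xO p)).
Proof.
  unfold stops; destruct (excluded_middle_informative _) as [(x & E & H)|]; [|discriminate].
  intros _; cbn [label]; rewrite E; auto.
Qed.

Lemma stops_intro A p : label A p = OS (label A (xO p)) ->
  ole (OS OZ) (label A (xO p)) -> stops A p = true.
Proof.
  intros E H; unfold stops; destruct (excluded_middle_informative _) as [|N]; [reflexivity|].
  destruct N; eauto.
Qed.

Lemma label_xO A p : ole (label A (xO p)) (label A p).
Proof.
  cbn [label]; destruct (label A p) as [|x|f].
  - apply ole_zero.
  - apply ole_OS_self.
  - apply ole_cocone with O, ole_refl.
Qed.

Lemma label_xI A p : ole (label A (xI p)) (label A p).
Proof.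
  cbn [label]; destruct (label A p) as [|x|f]; try apply ole_zero.
  apply ole_limiting; intros k; apply ole_cocone with (S k), ole_refl.
Qed.

(* The square where wire [xI p] branches off belongs to column [p], whereas
   the top of column [p] belongs to wire [xO p]. *)
Definition on_segment (w : positive) (u v : Z) : Prop :=
  (v = 12 * height w + 4 /\
   12 * (Zpos w / 2) + match w with xI _ => 6 | _ => 4 end <= u <= 12 * Zpos w + 4 /\
   u mod 2 = 0) \/
  (u = 12 * Zpos w + 4 /\
   12 * height w + 4 <= v < 12 * (2 * height w + 2) + 4 /\ v mod 2 = 0).

Definition stop_square (st : positive -> bool) (p : positive) (u v : Z) : Prop :=
  st p = true /\ u = 12 * Zpos p + 4 /\ v = 12 * (2 * height p + 2) + 4.

Definition up_dir (du dv : Z) : Prop := (du = 1 /\ dv = 0) \/ (du = 0 /\ dv = 1).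

Definition child (w w' : positive) : Prop := w' = w \/ w' = xO w \/ w' = xI w.

Lemma on_segment_path st w u v : on_segment w u v -> path st u v = true /\ 4 <= u.
Proof.
  pose proof (height_nonneg w).
  intros [(-> & Hu & _)|(-> & Hv & _)].
  - split; [apply row_path; destruct w; lia|destruct w; lia].
  - split; [apply column_path; lia|lia].
Qed.

(** The red pawn on the third square is the captor of a runner that rests on the second one: it
    lands on the first, which the runner's own capture has emptied. *)
Lemma segment_step st w u v du dv :
  on_segment w u v -> up_dir du dv -> path st (u + 2 * du) (v + 2 * dv) = true ->
  path st (u + du) (v + dv) = true /\
  exists w', child w w' /\ on_segment w' (u + 2 * du) (v + 2 * dv) /\
    ((w' = xO w /\ stop_square st w (u + 2 * du) (v + 2 * dv)) \/
     (path st (u + 3 * du) (v + 3 * dv) = true /\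
      init st (u + 3 * du) (v + 3 * dv) = Some rpawn)).
Proof.
  intros Hs Hd Hp; pose proof (height_nonneg w) as Hh.
  assert (Hcase : (v = 12 * height w + 4 /\ u < 12 * Zpos w + 4 /\
     12 * (Zpos w / 2) + match w with xI _ => 6 | _ => 4 end <= u /\ u mod 2 = 0) \/
     (u = 12 * Zpos w + 4 /\
      12 * height w + 4 <= v < 12 * (2 * height w + 2) + 4 /\ v mod 2 = 0)).
  { destruct Hs as [(-> & Hu & He)|Hs]; [|auto].
    destruct (Z.eq_dec u (12 * Zpos w + 4)); [right|left]; lia. }
  clear Hs; destruct Hd as [[-> ->]|[-> ->]];
    destruct Hcase as [(-> & Hu & Hu' & He)|(-> & Hv & He)].
  - replace (12 * height w + 4 + 0) with (12 * height w + 4) by ring.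
    replace (12 * height w + 4 + 2 * 0) with (12 * height w + 4) by ring.
    replace (12 * height w + 4 + 3 * 0) with (12 * height w + 4) by ring.
    split; [apply row_path; destruct w; lia|].
    exists w; split; [left; reflexivity|split].
    + left; split; [reflexivity|destruct w; lia].
    + right; split; [apply row_path; destruct w; lia|].
      rewrite row_content by (destruct w; lia).
      destruct (Z.eqb_spec ((u + 3 * 1) mod 2) 0); [lia|reflexivity].
  - replace (v + 2 * 0) with v in * by ring; replace (v + 0) with v by ring.
    replace (v + 3 * 0) with v by ring.
    replace (2 * 1) with 2 in * by ring.
    pose proof (right_of_column st w v Hv Hp) as ->.
    assert (Hpar : Zpos (xI w) / 2 = Zpos w) by lia.
    assert (Hrow : 12 * height (xI w) + 4 = 12 * (2 * height w + 1) + 4) by reflexivity.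
    rewrite <- Hrow.
    split; [apply row_path; lia|].
    exists (xI w); split; [unfold child; auto|split].
    + left; split; [reflexivity|lia].
    + right; split; [apply row_path; lia|].
      rewrite row_content by lia.
      destruct (Z.eqb_spec ((12 * Zpos w + 4 + 3 * 1) mod 2) 0); [lia|reflexivity].
  - exfalso; replace (u + 2 * 0) with u in Hp by ring.
    rewrite above_row in Hp; [discriminate| |intros p ->; lia].
    destruct w; lia.
  - replace (12 * Zpos w + 4 + 0) with (12 * Zpos w + 4) by ring.
    replace (12 * Zpos w + 4 + 2 * 0) with (12 * Zpos w + 4) by ring.
    replace (12 * Zpos w + 4 + 3 * 0) with (12 * Zpos w + 4) by ring.
    split; [apply column_path; lia|].
    destruct (Z.eq_dec (v + 2 * 1) (12 * (2 * height w + 2) + 4)) as [E|N].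
    + exists (xO w); split; [unfold child; auto|].
      split; [left; cbn [height]; lia|].
      destruct (st w) eqn:Hst.
      * left; unfold stop_square; auto.
      * right; split; [apply column_path; lia|].
        rewrite column_content by (auto; lia).
        destruct (Z.eqb_spec ((v + 3 * 1) mod 2) 0); [lia|reflexivity].
    + exists w; split; [left; reflexivity|split].
      * right; lia.
      * right; split; [apply column_path; lia|].
        rewrite column_content by lia.
        destruct (Z.eqb_spec ((v + 3 * 1) mod 2) 0); [lia|reflexivity].
Qed.

Lemma stop_exit st p u v : stop_square st p u v -> path st u (v + 2) = false.
Proof.
  intros (H & -> & ->).
  replace (12 * (2 * height p + 2) + 4 + 2) with (12 * (2 * height p + 2) + 6) by ring.
  rewrite path_local, tile_top, H by lia; reflexivity.
Qed.

Lemma child_label A w w' : child w w' -> ole (label A w') (label A w).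
Proof.
  intros [-> | [-> | ->]]; [apply ole_refl|apply label_xO|apply label_xI].
Qed.

(** * The invariant of Red's strategy *)

(** [r] is the only path square on which Black may stand. Off the path nothing changes, because the
    runner and all chosen replies of Red stay on it. *)
Definition quiet (st : positive -> bool) (r : option (Z * Z)) (b : board) : Prop :=
  (forall s, (fst s + snd s) mod 2 <> 0 -> b s = None) /\
  (forall u v, path st u v = false -> b (sq u v) = init st u v) /\
  (forall u v pc, path st u v = true -> Some (u, v) <> r ->
     b (sq u v) = Some pc -> pcolor pc = Red).

Lemma dark_sq s : (fst s + snd s) mod 2 = 0 -> exists u v, s = sq u v.
Proof.
  destruct s as [x y]; cbn [fst snd]; intros H.
  exists ((x + y) / 2), ((y - x) / 2); unfold sq; f_equal; lia.
Qed.

Lemma quiet_black st r b s pc dx dy k :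
  quiet st r b -> b s = Some pc -> pcolor pc = Black -> allowed_dir pc dx dy ->
  k = 1 \/ k = 2 -> b (shift s k dx dy) = None ->
  exists u v, s = sq u v /\ r = Some (u, v).
Proof.
  intros (Q1 & Q2 & Q3) Hs Hc Hd Hk Hn.
  destruct (Z.eq_dec ((fst s + snd s) mod 2) 0) as [E|E];
    [|rewrite Q1 in Hs by assumption; discriminate].
  destruct (dark_sq s E) as (u & v & ->).
  exists u, v; split; [reflexivity|].
  destruct (path st u v) eqn:P.
  - destruct r as [[u' v']|].
    + destruct (Z.eq_dec u u'), (Z.eq_dec v v'); try (subst; reflexivity);
      rewrite (Q3 u v pc) in Hc; try discriminate; auto; congruence.
    + rewrite (Q3 u v pc) in Hc; try discriminate; auto.
  - rewrite Q2 in Hs by assumption.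
    destruct (init_black _ _ _ _ _ _ _ Hs Hc Hd Hk) as (u' & v' & E' & P').
    rewrite E', Q2 in Hn by assumption.
    apply init_none in Hn; congruence.
Qed.

Lemma quiet_won st p : quiet st None (pboard p) -> pturn p = Black -> won_open p.
Proof.
  intros Q T; split; [exact T|].
  intros q (_ & b' & _ & H); rewrite T in H.
  assert (Hj : forall pc s b' s', pcolor pc = Black -> jump_step pc (pboard p) s b' s' -> False).
  { intros pc s b1 s1 Hpc (dx & dy & Hd & Hs & _ & Hl & _).
    destruct (quiet_black st None (pboard p) s pc dx dy 2) as (u & v & _ & E);
      auto; discriminate. }
  destruct H as [H|[(pc & s & s' & Hpc & H)|(pc & s & Hpc & H)]].
  - destruct H as (s & pc & dx & dy & Hs & Hpc & Hd & Hl & _).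
    destruct (quiet_black st None (pboard p) s pc dx dy 1) as (u & v & _ & E);
      auto; discriminate.
  - destruct H as [b s b' s' H|b s b1 s1 b' s' H _]; eauto.
  - destruct H as (ss & bs & <- & E & Hstep & _).
    specialize (Hstep O); rewrite E in Hstep; eauto.
Qed.

(* Provides Red with a move when the runner vanishes in an infinite jump. *)
Definition spare (b : board) : Prop :=
  b (sq (-7) 4) = Some rpawn /\ b (sq (-8) 4) = None.

Definition runner_at (st : positive -> bool) (u v : Z) (b : board) : Prop :=
  quiet st (Some (u, v)) b /\ spare b /\ b (sq u v) = Some bpawn.

Definition fresh_ahead (st : positive -> bool) (u v : Z) (b : board) : Prop :=
  forall u' v', u < u' \/ (u = u' /\ v < v') -> b (sq u' v') = init st u' v'.

(** Describes the board after Red has filled the square above a stop. From there the runner can only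
    jump to the right, by two columns, which restores [fresh_ahead]. *)
Definition fresh_beyond (st : positive -> bool) (u v : Z) (b : board) : Prop :=
  (exists p, stop_square st p u v) /\
  forall u' v', u + 2 <= u' -> b (sq u' v') = init st u' v'.

Lemma update_sq b u v w u' v' : (u', v') <> (u, v) ->
  update b (sq u v) w (sq u' v') = b (sq u' v').
Proof.
  intros N; apply update_neq; intros E; apply sq_inj in E as [-> ->]; congruence.
Qed.

Lemma update_sq_neq b u v w u' v' : u' <> u \/ v' <> v ->
  update b (sq u v) w (sq u' v') = b (sq u' v').
Proof. intros N; apply update_sq; intros [= -> ->]; lia. Qed.

Lemma sq_parity u v : (fst (sq u v) + snd (sq u v)) mod 2 = 0.
Proof. unfold sq; cbn [fst snd]; lia. Qed.

Lemma quiet_update st r b u v w :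
  quiet st r b -> path st u v = true ->
  (forall pc, w = Some pc -> pcolor pc = Red) -> quiet st r (update b (sq u v) w).
Proof.
  intros (Q1 & Q2 & Q3) P W; split; [|split].
  - intros s Hs; rewrite update_neq; auto.
    intros ->; apply Hs, sq_parity.
  - intros u' v' P'; rewrite update_sq; auto; congruence.
  - intros u' v' pc P' N; unfold update; destruct (sq_eqb _ _); eauto.
Qed.

Lemma quiet_lift st u v b :
  quiet st (Some (u, v)) b -> path st u v = true ->
  quiet st None (update b (sq u v) None).
Proof.
  intros (Q1 & Q2 & Q3) P; split; [|split].
  - intros s Hs; rewrite update_neq; auto.
    intros ->; apply Hs, sq_parity.
  - intros u' v' P'; rewrite update_sq; auto; congruence.
  - intros u' v' pc P' _; unfold update.
    destruct (sq_eqb_spec (sq u' v') (sq u v)) as [E|N]; [discriminate|].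
    apply Q3; auto; intros [= -> ->]; apply N; reflexivity.
Qed.

Lemma quiet_put st u v b w :
  quiet st None b -> path st u v = true ->
  quiet st (Some (u, v)) (update b (sq u v) w).
Proof.
  intros (Q1 & Q2 & Q3) P; split; [|split].
  - intros s Hs; rewrite update_neq; auto.
    intros ->; apply Hs, sq_parity.
  - intros u' v' P'; rewrite update_sq; auto; congruence.
  - intros u' v' pc P' N; rewrite update_sq by congruence.
    apply Q3; congruence.
Qed.

Lemma quiet_ext st r b b' : (forall x, b' x = b x) -> quiet st r b -> quiet st r b'.
Proof.
  intros E (Q1 & Q2 & Q3); split; [|split]; intros *; rewrite E; eauto.
Qed.

Lemma shift_sq u v k dx dy du dv : dx = du - dv -> dy = du + dv ->
  shift (sq u v) k dx dy = sq (u + k * du) (v + k * dv).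
Proof. intros -> ->; unfold shift, sq; cbn [fst snd]; f_equal; ring. Qed.

Lemma allowed_up pc dx dy : allowed_dir pc dx dy -> pc = bpawn ->
  exists du dv, up_dir du dv /\ dx = du - dv /\ dy = du + dv.
Proof.
  intros [[-> | ->] Hy] ->; simpl in Hy; subst dy.
  - exists 1, 0; unfold up_dir; lia.
  - exists 0, 1; unfold up_dir; lia.
Qed.

Definition jumped (u v du dv : Z) (b : board) : board :=
  update (update (update b (sq u v) None) (sq (u + du) (v + dv)) None)
    (sq (u + 2 * du) (v + 2 * dv)) (Some bpawn).

Lemma runner_jump st w u v b b' s' :
  on_segment w u v -> runner_at st u v b -> jump_step bpawn b (sq u v) b' s' ->
  exists du dv w', up_dir du dv /\ child w w' /\
    s' = sq (u + 2 * du) (v + 2 * dv) /\ b' = jumped u v du dv b /\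
    midpoint (sq u v) s' = sq (u + du) (v + dv) /\
    path st (u + du) (v + dv) = true /\
    on_segment w' (u + 2 * du) (v + 2 * dv) /\
    runner_at st (u + 2 * du) (v + 2 * dv) b' /\
    ((exists p, stop_square st p u v) -> du = 1 /\ dv = 0) /\
    ((w' = xO w /\ stop_square st w (u + 2 * du) (v + 2 * dv)) \/
     (path st (u + 3 * du) (v + 3 * dv) = true /\
      init st (u + 3 * du) (v + 3 * dv) = Some rpawn)).
Proof.
  intros Hw (Q & [Sp1 Sp2] & Hr) (dx & dy & Hd & _ & (e & He & _) & Hl & -> & ->).
  destruct (allowed_up _ _ _ Hd eq_refl) as (du & dv & Hup & Hx & Hy).
  rewrite (shift_sq u v 1 _ _ _ _ Hx Hy), !Z.mul_1_l in *.
  rewrite (shift_sq u v 2 _ _ _ _ Hx Hy) in *.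
  assert (P2 : path st (u + 2 * du) (v + 2 * dv) = true).
  { destruct (path st _ _) eqn:E; [reflexivity|].
    destruct Q as (_ & Q2 & _); rewrite Q2 in Hl by assumption.
    apply init_none in Hl; congruence. }
  destruct (segment_step st w u v du dv Hw Hup P2) as (P1 & w' & Hc & Hw' & Hout).
  destruct (on_segment_path st w u v Hw) as [P0 Hu].
  exists du, dv, w'; split; [exact Hup|]; split; [exact Hc|]; split; [reflexivity|].
  split; [reflexivity|]; split.
  { rewrite <- (shift_sq u v 2 _ _ _ _ Hx Hy), midpoint_shift, (shift_sq u v 1 _ _ _ _ Hx Hy).
    rewrite !Z.mul_1_l; reflexivity. }
  split; [exact P1|]; split; [exact Hw'|]; split.
  { split; [|split].
    - apply quiet_put; auto; apply quiet_update; [|exact P1|discriminate].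
      apply quiet_lift; auto.
    - split; unfold up_dir in Hup; rewrite !update_sq_neq by lia; assumption.
    - apply update_eq. }
  split; [|exact Hout].
  intros (p & Hp); pose proof (stop_exit _ _ _ _ Hp) as Hn.
  destruct Hup as [|[-> ->]]; [assumption|].
  replace (u + 2 * 0) with u in P2 by ring; replace (2 * 1) with 2 in P2 by ring.
  congruence.
Qed.

Lemma jumped_fresh st u v du dv b :
  up_dir du dv -> ((exists p, stop_square st p u v) -> du = 1 /\ dv = 0) ->
  fresh_ahead st u v b \/ fresh_beyond st u v b ->
  fresh_ahead st (u + 2 * du) (v + 2 * dv) (jumped u v du dv b).
Proof.
  intros Hd Hs H u' v' Ha; unfold jumped.
  unfold up_dir in Hd; rewrite !update_sq_neq by lia.
  destruct H as [H|[Hp H]]; apply H.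
  - destruct Hd; lia.
  - destruct (Hs Hp); lia.
Qed.

Lemma runner_at_ext st u v b b' :
  (forall x, b' x = b x) -> runner_at st u v b -> runner_at st u v b'.
Proof.
  intros E (Q & [S1 S2] & H).
  unfold runner_at, spare; rewrite !E; eauto using quiet_ext.
Qed.

Lemma fresh_ahead_ext st u v b b' :
  (forall x, b' x = b x) -> fresh_ahead st u v b -> fresh_ahead st u v b'.
Proof. intros E H u' v' Ha; rewrite E; auto. Qed.

(** Labels never increase along a chain, and a landing on the stop of column [p] is paid for because
    [label A p] is the successor of [label A (xO p)]. Every other landing square lies between an
    emptied square and a red pawn, so Red can capture. *)
Lemma runner_chain A b s b' s' :
  jchain bpawn b s b' s' -> forall w u v, s = sq u v ->
  on_segment w u v -> runner_at (stops A) u v b ->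
  fresh_ahead (stops A) u v b \/ fresh_beyond (stops A) u v b ->
  exists u' v', runner_at (stops A) u' v' b' /\ fresh_ahead (stops A) u' v' b' /\
    path (stops A) u' v' = true /\
    ((exists p, stop_square (stops A) p u' v' /\ ole (OS (label A (xO p))) (label A w)) \/
     exists du dv, up_dir du dv /\
       path (stops A) (u' - du) (v' - dv) = true /\ b' (sq (u' - du) (v' - dv)) = None /\
       path (stops A) (u' + du) (v' + dv) = true /\
       init (stops A) (u' + du) (v' + dv) = Some rpawn).
Proof.
  induction 1 as [b s b' s' H|b s b1 s1 b' s' H _ IH]; intros w u v -> Hw Hr Hf;
    destruct (runner_jump _ _ _ _ _ _ _ Hw Hr H)
      as (du & dv & w' & Hd & Hc & -> & -> & _ & P1 & Hw' & Hr' & Hs & Hout);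
    pose proof (jumped_fresh _ _ _ _ _ _ Hd Hs Hf) as Hf'.
  - exists (u + 2 * du), (v + 2 * dv).
    split; [exact Hr'|]; split; [exact Hf'|].
    split; [apply (on_segment_path _ _ _ _ Hw')|].
    destruct Hout as [[-> Hst]|[Hp Hi]].
    + left; exists w; split; [exact Hst|].
      destruct Hst as [Hst _]; destruct (stops_true _ _ Hst) as [<- _]; apply ole_refl.
    + right; exists du, dv; split; [exact Hd|].
      replace (u + 2 * du - du) with (u + du) by ring.
      replace (v + 2 * dv - dv) with (v + dv) by ring.
      replace (u + 2 * du + du) with (u + 3 * du) by ring.
      replace (v + 2 * dv + dv) with (v + 3 * dv) by ring.
      split; [exact P1|]; split; [|auto].
      unfold jumped; unfold up_dir in Hd; rewrite update_sq_neq by lia; apply update_eq.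
  - destruct (IH w' _ _ eq_refl Hw' Hr' (or_introl Hf'))
      as (u' & v' & R1 & R2 & R3 & R4).
    exists u', v'; repeat (split; [assumption|]).
    destruct R4 as [(p & Hp & Hle)|R4]; [left|right; exact R4].
    exists p; split; [exact Hp|].
    apply ole_trans with (1 := Hle), child_label, Hc.
Qed.

(** * Red's replies: capture, fill, wait *)

Lemma red_captures st u v du dv q :
  pturn q = Red -> runner_at st u v (pboard q) -> path st u v = true -> up_dir du dv ->
  path st (u - du) (v - dv) = true -> pboard q (sq (u - du) (v - dv)) = None ->
  path st (u + du) (v + dv) = true -> pboard q (sq (u + du) (v + dv)) = Some rpawn ->
  exists r, move q r /\ won_open r.
Proof.
  intros T (Q & _ & H) P Hd P1 H1 P3 H3.
  exists (Pos (update (update (update (pboard q) (sq (u + du) (v + dv)) None) (sq u v) None)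
                 (sq (u - du) (v - dv)) (Some rpawn)) Black).
  split.
  - split; [rewrite T; reflexivity|]; eexists; split; [reflexivity|].
    right; left; exists rpawn; do 2 eexists; split; [rewrite T; reflexivity|].
    apply jc_one with (s := sq (u + du) (v + dv)) (s' := sq (u - du) (v - dv)).
    exists (- (du - dv)), (- (du + dv)).
    rewrite (shift_sq _ _ 1 _ _ (- du) (- dv)), (shift_sq _ _ 2 _ _ (- du) (- dv)) by ring.
    replace (u + du + 1 * - du) with u by ring.
    replace (v + dv + 1 * - dv) with v by ring.
    replace (u + du + 2 * - du) with (u - du) by ring.
    replace (v + dv + 2 * - dv) with (v - dv) by ring.
    repeat split; auto.
    + unfold up_dir in Hd; lia.
    + unfold up_dir in Hd; simpl; lia.
    + exists bpawn; split; [exact H|discriminate].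
  - apply quiet_won with st; [|reflexivity].
    apply quiet_update; [|exact P1|intros pc [= <-]; reflexivity].
    apply quiet_lift; [|exact P].
    apply quiet_update; [exact Q|exact P3|discriminate].
Qed.

Lemma stop_path st p u v du dv : stop_square st p u v ->
  -4 <= du < 8 -> -4 <= dv < 8 ->
  path st (u + du) (v + dv) = in_path Stop (4 + du) (4 + dv).
Proof.
  intros (H & -> & ->) Hu Hv.
  replace (12 * Zpos p + 4 + du) with (12 * Zpos p + (4 + du)) by ring.
  replace (12 * (2 * height p + 2) + 4 + dv)
    with (12 * (2 * height p + 2) + (4 + dv)) by ring.
  rewrite path_local, tile_top, H by lia; reflexivity.
Qed.

Lemma stop_init_path st p u v du dv : stop_square st p u v ->
  -4 <= du < 8 -> -4 <= dv < 8 -> in_path Stop (4 + du) (4 + dv) = true ->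
  init st (u + du) (v + dv) = path_content Stop (4 + du) (4 + dv).
Proof.
  intros Hs Hu Hv P.
  rewrite init_path by (rewrite (stop_path _ p) by assumption; exact P).
  destruct Hs as (H & -> & ->).
  replace (12 * Zpos p + 4 + du) with (12 * Zpos p + (4 + du)) by ring.
  replace (12 * (2 * height p + 2) + 4 + dv)
    with (12 * (2 * height p + 2) + (4 + dv)) by ring.
  rewrite !local_div, !local_mod, tile_top, H by lia; reflexivity.
Qed.

(** The two occupied neighbours deny the runner a simple move, so that every black move begins with
    a jump. *)
Definition ready (st : positive -> bool) (w : positive) (u v : Z) (b : board) : Prop :=
  on_segment w u v /\ runner_at st u v b /\
  (fresh_ahead st u v b \/ fresh_beyond st u v b) /\
  b (sq (u + 1) v) <> None /\ b (sq u (v + 1)) <> None.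

Lemma red_blocks st p u v q :
  pturn q = Red -> stop_square st p u v -> runner_at st u v (pboard q) ->
  fresh_ahead st u v (pboard q) ->
  exists r, move q r /\ pturn r = Black /\ ready st (xO p) u v (pboard r).
Proof.
  intros T Hs (Q & [S1 S2] & H) Hf.
  assert (HB : pboard q (sq u (v + 1)) = None).
  { rewrite Hf by lia; replace u with (u + 0) by ring.
    rewrite (stop_init_path st p) by (auto; lia); reflexivity. }
  assert (HF : pboard q (sq (u + 1) (v + 1)) = Some rpawn).
  { rewrite Hf by lia; rewrite (stop_init_path st p) by (auto; lia); reflexivity. }
  assert (HR : pboard q (sq (u + 1) v) = Some rpawn).
  { rewrite Hf by lia; replace v with (v + 0) by ring.
    rewrite (stop_init_path st p) by (auto; lia); reflexivity. }
  assert (PB : path st u (v + 1) = true).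
  { replace u with (u + 0) by ring; rewrite (stop_path st p) by (auto; lia); reflexivity. }
  assert (PF : path st (u + 1) (v + 1) = true).
  { rewrite (stop_path st p) by (auto; lia); reflexivity. }
  assert (Hu : 4 <= u) by (destruct Hs as (_ & -> & _); lia).
  exists (Pos (update (update (pboard q) (sq (u + 1) (v + 1)) None)
                 (sq u (v + 1)) (Some rpawn)) Black).
  split; [|split; [reflexivity|]].
  - split; [rewrite T; reflexivity|]; eexists; split; [reflexivity|].
    left; exists (sq (u + 1) (v + 1)), rpawn, (-1), (-1).
    rewrite (shift_sq _ _ 1 _ _ (-1) 0) by lia.
    replace (u + 1 + 1 * -1) with u by ring.
    replace (v + 1 + 1 * 0) with (v + 1) by ring.
    rewrite T; repeat split; auto.
  - cbn [pboard]; split; [|split; [|split; [|split]]].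
    + left; destruct Hs as (_ & -> & ->); cbn [height]; lia.
    + split; [|split].
      * apply quiet_update; auto; [|intros pc [= <-]; reflexivity].
        apply quiet_update; auto; discriminate.
      * split; rewrite !update_sq_neq by lia; assumption.
      * rewrite !update_sq_neq by lia; assumption.
    + right; split; [exists p; exact Hs|].
      intros u' v' Ha; rewrite !update_sq_neq by lia; apply Hf; lia.
    + rewrite !update_sq_neq by lia; congruence.
    + rewrite update_eq; discriminate.
Qed.

Lemma red_tempo st q :
  pturn q = Red -> quiet st None (pboard q) -> spare (pboard q) ->
  exists r, move q r /\ won_open r.
Proof.
  intros T Q [S1 S2].
  exists (Pos (update (update (pboard q) (sq (-7) 4) None) (sq (-8) 4) (Some rpawn)) Black).
  split.
  - split; [rewrite T; reflexivity|]; eexists; split; [reflexivity|].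
    left; exists (sq (-7) 4), rpawn, (-1), (-1).
    rewrite T; repeat split; auto.
  - apply quiet_won with st; [|reflexivity].
    apply quiet_update; [|reflexivity|intros pc [= <-]; reflexivity].
    apply quiet_update; [exact Q|reflexivity|discriminate].
Qed.

(** All squares touched lie on the path and have [4 <= u], so erasing them keeps the board quiet and
    spares the pawn kept at negative [u]. *)
Lemma infinite_run st w u v b b' s :
  ready st w u v b -> inf_jump bpawn b s b' -> s = sq u v ->
  quiet st None b' /\ spare b'.
Proof.
  intros (Hw & Hr & _) (ss & bs & H0 & E0 & Hstep & Hb') ->.
  assert (Hn : forall n, exists w' u' v', ss n = sq u' v' /\ on_segment w' u' v' /\
            runner_at st u' v' (bs n)).
  { induction n as [|n (w' & u' & v' & E & Hw' & Hr')].
    - exists w, u, v; rewrite E0; auto.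
    - pose proof (Hstep n) as Hj; rewrite E in Hj.
      destruct (runner_jump _ _ _ _ _ _ _ Hw' Hr' Hj)
        as (du & dv & w2 & _ & _ & E' & _ & _ & _ & Hw2 & Hr2 & _).
      eauto 6. }
  assert (Ht : forall n x, x = ss n \/ x = midpoint (ss n) (ss (S n)) ->
            exists u' v', x = sq u' v' /\ path st u' v' = true /\ 4 <= u').
  { intros n x Hx; destruct (Hn n) as (w' & u' & v' & E & Hw' & Hr').
    destruct (on_segment_path st w' u' v' Hw') as [P Hu].
    destruct Hx as [->|Hx]; [eauto|].
    pose proof (Hstep n) as Hj; rewrite E in Hj, Hx.
    destruct (runner_jump _ _ _ _ _ _ _ Hw' Hr' Hj)
      as (du & dv & w2 & Hd & _ & _ & _ & Em & P1 & _).
    exists (u' + du), (v' + dv); rewrite Hx, Em; unfold up_dir in Hd.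
    repeat split; auto; lia. }
  destruct Hr as ((Q1 & Q2 & Q3) & [S1 S2] & Hr).
  split; [split; [|split]|split].
  - intros x Hx; destruct (Hb' x) as [Hyes Hno].
    destruct (classic (exists n, x = ss n \/ x = midpoint (ss n) (ss (S n)))) as [X|X];
      [auto|rewrite Hno; auto].
  - intros u' v' P; destruct (Hb' (sq u' v')) as [_ Hno]; rewrite Hno; [auto|].
    intros [n Hx]; destruct (Ht n _ Hx) as (u2 & v2 & E & P' & _).
    apply sq_inj in E as [-> ->]; congruence.
  - intros u' v' pc P _ Hx; destruct (Hb' (sq u' v')) as [Hyes Hno].
    destruct (classic (exists n, sq u' v' = ss n \/
                         sq u' v' = midpoint (ss n) (ss (S n)))) as [X|X].
    + rewrite Hyes in Hx; [discriminate|exact X].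
    + rewrite Hno in Hx by exact X; apply Q3 in Hx; auto.
      intros [= -> ->]; apply X; exists O; auto.
  - destruct (Hb' (sq (-7) 4)) as [_ Hno]; rewrite Hno; [exact S1|].
    intros [n Hx]; destruct (Ht n _ Hx) as (u2 & v2 & E & _ & Hu).
    apply sq_inj in E; lia.
  - destruct (Hb' (sq (-8) 4)) as [_ Hno]; rewrite Hno; [exact S2|].
    intros [n Hx]; destruct (Ht n _ Hx) as (u2 & v2 & E & _ & Hu).
    apply sq_inj in E; lia.
Qed.

Lemma ready_black_move st w u v b s pc dx dy k :
  ready st w u v b -> b s = Some pc -> pcolor pc = Black -> allowed_dir pc dx dy ->
  k = 1 \/ k = 2 -> b (shift s k dx dy) = None -> s = sq u v /\ pc = bpawn /\ k = 2.
Proof.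
  intros (_ & (Q & _ & Hr) & _ & N1 & N2) Hs Hc Hd Hk Hn.
  destruct (quiet_black _ _ _ _ _ _ _ _ Q Hs Hc Hd Hk Hn) as (u' & v' & -> & [= <- <-]).
  rewrite Hr in Hs; injection Hs as <-.
  split; [reflexivity|]; split; [reflexivity|].
  destruct Hk as [->|]; [|assumption].
  destruct (allowed_up _ _ _ Hd eq_refl) as (du & dv & Hup & Hx & Hy).
  rewrite (shift_sq _ _ 1 _ _ _ _ Hx Hy), !Z.mul_1_l in Hn.
  destruct Hup as [[-> ->]|[-> ->]]; rewrite Z.add_0_r in Hn; contradiction.
Qed.

(** Well-founded induction on the label, which drops strictly at each stop. The bound [1] on [a]
    pays for the single turn in which Red captures a runner off the stops or waits after an infinite
    jump. *)
Lemma upper_bound A w u v p a :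
  pturn p = Black -> ready (stops A) w u v (pboard p) ->
  ole (label A w) a -> ole (OS OZ) a -> val_le p a.
Proof.
  revert u v p a; remember (label A w) as x eqn:Ex; revert w Ex.
  induction x as [x IH] using (well_founded_induction olt_wf).
  intros w Ex u v p a T Hr Hx H1.
  destruct (classic (won_open p)) as [W|W]; [apply vl_won, W|].
  apply vl_closed; [exact T|exact W|].
  intros q (Tq & b' & E & H); rewrite T in *; cbn [other] in Tq.
  assert (Hwon : (exists r, move q r /\ won_open r) -> val_le q a).
  { intros (r & Hm & Wr); apply vl_open with r OZ; auto; apply vl_won, Wr. }
  assert (Hj : forall pc s b1 s1, pcolor pc = Black -> jump_step pc (pboard p) s b1 s1 ->
            s = sq u v /\ pc = bpawn).
  { intros pc s b1 s1 Hpc (dx & dy & Hd & Hs & _ & Hl & _).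
    destruct (ready_black_move _ _ _ _ _ _ _ _ _ 2 Hr Hs Hpc Hd) as (? & ? & _); auto. }
  destruct H as [H|[(pc & s & s' & Hpc & H)|(pc & s & Hpc & H)]].
  - destruct H as (s & pc & dx & dy & Hs & Hpc & Hd & Hl & _).
    destruct (ready_black_move _ _ _ _ _ _ _ _ _ 1 Hr Hs Hpc Hd) as (_ & _ & C); auto.
    discriminate.
  - assert (s = sq u v /\ pc = bpawn) as [-> ->] by (destruct H; eauto).
    destruct Hr as (Hw & Hr & Hf & _).
    destruct (runner_chain A _ _ _ _ H w u v eq_refl Hw Hr Hf)
      as (u' & v' & Hr' & Hf' & P & [(p' & Hst & Hle)|(du & dv & Hd & P1 & Hn & P3 & Hi)]);
      apply (runner_at_ext _ _ _ _ _ E) in Hr'; apply (fresh_ahead_ext _ _ _ _ _ E) in Hf'.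
    + destruct (red_blocks _ _ _ _ _ Tq Hst Hr' Hf') as (r & Hm & Tr & Rr).
      destruct (stops_true A p' (proj1 Hst)) as [_ Hge].
      apply vl_open with r (label A (xO p')); auto.
      * apply (IH (label A (xO p'))) with (w := xO p') (u := u') (v := v'); auto using ole_refl.
        rewrite Ex; exact Hle.
      * apply ole_trans with x; [rewrite Ex; exact Hle|exact Hx].
    + apply Hwon; apply (red_captures (stops A) u' v' du dv); auto.
      * rewrite E; exact Hn.
      * rewrite Hf' by (unfold up_dir in Hd; lia); exact Hi.
  - assert (s = sq u v /\ pc = bpawn) as [Es ->].
    { destruct H as (ss & bs & <- & E0 & Hstep & _).
      specialize (Hstep O); rewrite E0 in Hstep; eauto. }
    destruct (infinite_run _ _ _ _ _ _ _ Hr H Es) as [Q [S1 S2]].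
    apply Hwon, red_tempo with (stops A); auto.
    + apply quiet_ext with (1 := E), Q.
    + unfold spare; rewrite !E; auto.
Qed.

Lemma start_ready st : ready st xH 4 4 (start_board st).
Proof.
  assert (Q : quiet st (Some (4, 4)) (start_board st)).
  { split; [|split].
    - intros s Hs; unfold start_board.
      destruct (sq_eqb_spec s (sq 4 4)) as [->|_]; [destruct (Hs (sq_parity 4 4))|].
      destruct (Z.eqb_spec ((fst s + snd s) mod 2) 0); [contradiction|reflexivity].
    - intros u v P; apply start_board_sq; intros [= -> ->]; discriminate.
    - intros u v pc P N; rewrite start_board_sq by congruence.
      apply path_not_black, P. }
  split; [left; cbn [height]; lia|].
  split; [split; [exact Q|split; [split; reflexivity|reflexivity]]|].
  split; [|split; discriminate].
  left; intros u v Ha; apply start_board_sq; intros [= -> ->]; lia.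
Qed.

(** * The lower bound *)

Definition reach (b : board) (s : square) (b' : board) (s' : square) : Prop :=
  (b' = b /\ s' = s) \/ jchain bpawn b s b' s'.

Lemma jchain_trans pc b s b1 s1 b2 s2 :
  jchain pc b s b1 s1 -> jchain pc b1 s1 b2 s2 -> jchain pc b s b2 s2.
Proof. induction 1; intros; eapply jc_more; eauto. Qed.

Lemma reach_trans b s b1 s1 b2 s2 :
  reach b s b1 s1 -> reach b1 s1 b2 s2 -> reach b s b2 s2.
Proof.
  intros [[-> ->]|H] [[-> ->]|H']; unfold reach; eauto using jchain_trans.
Qed.

Lemma up_jump b u v du dv :
  up_dir du dv -> b (sq u v) = Some bpawn -> b (sq (u + du) (v + dv)) = Some rpawn ->
  b (sq (u + 2 * du) (v + 2 * dv)) = None ->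
  jchain bpawn b (sq u v) (jumped u v du dv b) (sq (u + 2 * du) (v + 2 * dv)).
Proof.
  intros Hd Hb He Hl; apply jc_one; exists (du - dv), (du + dv).
  rewrite (shift_sq _ _ 1 _ _ du dv), (shift_sq _ _ 2 _ _ du dv), !Z.mul_1_l by ring.
  repeat split; auto.
  - unfold up_dir in Hd; lia.
  - unfold up_dir in Hd; simpl; lia.
  - exists rpawn; split; [exact He|discriminate].
Qed.

(** Up to column [m] Red's last reply may have disturbed the board, and only the runner's own row is
    known. Beyond [m] everything above the runner or to its right is untouched. *)
Definition clear_run (st : positive -> bool) (m u v : Z) (b : board) : Prop :=
  b (sq u v) = Some bpawn /\
  forall u' v', (u < u' /\ v' = v) \/ (m < u' /\ (v < v' \/ u < u')) ->
    b (sq u' v') = init st u' v'.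

Lemma clear_run_jump st m u v b du dv :
  clear_run st m u v b -> up_dir du dv -> (dv = 1 -> m < u) ->
  init st (u + du) (v + dv) = Some rpawn -> init st (u + 2 * du) (v + 2 * dv) = None ->
  jchain bpawn b (sq u v) (jumped u v du dv b) (sq (u + 2 * du) (v + 2 * dv)) /\
  clear_run st m (u + 2 * du) (v + 2 * dv) (jumped u v du dv b).
Proof.
  intros [Hr Hc] Hd Hm H1 H2; split.
  - apply up_jump; auto; rewrite Hc; auto; unfold up_dir in Hd; lia.
  - split; [apply update_eq|].
    intros u' v' Ha; unfold jumped; unfold up_dir in Hd.
    rewrite !update_sq_neq by lia; apply Hc; lia.
Qed.

Lemma run_row st w m n : forall u b,
  clear_run st m u (12 * height w + 4) b -> 12 * (Zpos w / 2) + 4 <= u ->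
  u mod 2 = 0 -> u + 2 * Z.of_nat n = 12 * Zpos w + 4 ->
  exists b', reach b (sq u (12 * height w + 4)) b' (sq (12 * Zpos w + 4) (12 * height w + 4)) /\
    clear_run st m (12 * Zpos w + 4) (12 * height w + 4) b'.
Proof.
  induction n as [|n IH]; intros u b Hc Hu He Hn.
  - exists b; replace u with (12 * Zpos w + 4) in * by lia.
    split; [left; auto|exact Hc].
  - destruct (clear_run_jump st m u (12 * height w + 4) b 1 0) as [Hj Hc']; auto.
    + left; auto.
    + lia.
    + rewrite Z.add_0_r, row_content by lia.
      destruct (Z.eqb_spec ((u + 1) mod 2) 0); [lia|reflexivity].
    + rewrite Z.mul_0_r, Z.add_0_r, row_content by lia.
      destruct (Z.eqb_spec ((u + 2 * 1) mod 2) 0); [reflexivity|lia].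
    + rewrite Z.mul_0_r, Z.add_0_r, Z.mul_1_r in *.
      destruct (IH (u + 2) _ Hc') as (b' & Hr & Hc2); try lia.
      exists b'; split; [|exact Hc2].
      eapply reach_trans; [right; exact Hj|exact Hr].
Qed.

Lemma run_column st w m n : forall v b,
  clear_run st m (12 * Zpos w + 4) v b -> m < 12 * Zpos w + 4 ->
  12 * height w + 4 <= v -> v mod 2 = 0 ->
  v + 2 * Z.of_nat n <= 12 * (2 * height w + 2) + 4 ->
  exists b', reach b (sq (12 * Zpos w + 4) v) b' (sq (12 * Zpos w + 4) (v + 2 * Z.of_nat n)) /\
    clear_run st m (12 * Zpos w + 4) (v + 2 * Z.of_nat n) b'.
Proof.
  induction n as [|n IH]; intros v b Hc Hm Hv He Hn.
  - exists b; replace (v + 2 * Z.of_nat 0) with v by lia.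
    split; [left; auto|exact Hc].
  - destruct (clear_run_jump st m (12 * Zpos w + 4) v b 0 1) as [Hj Hc']; auto.
    + right; auto.
    + rewrite Z.add_0_r, column_content by lia.
      destruct (Z.eqb_spec ((v + 1) mod 2) 0); [lia|reflexivity].
    + rewrite Z.mul_0_r, Z.add_0_r, column_content by lia.
      destruct (Z.eqb_spec ((v + 2 * 1) mod 2) 0); [reflexivity|lia].
    + rewrite Z.mul_0_r, Z.add_0_r, Z.mul_1_r in *.
      destruct (IH (v + 2) _ Hc') as (b' & Hr & Hc2); try lia.
      replace (v + 2 + 2 * Z.of_nat n) with (v + 2 * Z.of_nat (S n)) in * by lia.
      exists b'; split; [|exact Hc2].
      eapply reach_trans; [right; exact Hj|exact Hr].
Qed.

Inductive descendant (j : positive) : positive -> Prop :=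
| descendant_refl : descendant j j
| descendant_xO w : descendant j w -> descendant j (xO w)
| descendant_xI w : descendant j w -> descendant j (xI w).

Lemma descendant_trans i j k : descendant i j -> descendant j k -> descendant i k.
Proof. intros H; induction 1; auto using descendant. Qed.

Lemma descendant_ge j w : descendant j w -> Zpos j <= Zpos w.
Proof. induction 1; lia. Qed.

Definition first_u (w : positive) : Z := 12 * (Zpos w / 2) + 4.
Definition first_v (w : positive) : Z := 12 * height w + 4.

Lemma run_to_column st w m b :
  clear_run st m (first_u w) (first_v w) b ->
  exists b', reach b (sq (first_u w) (first_v w)) b' (sq (12 * Zpos w + 4) (first_v w)) /\
    clear_run st m (12 * Zpos w + 4) (first_v w) b'.
Proof.
  intros Hc; unfold first_u, first_v in *.
  apply run_row with (n := Z.to_nat ((12 * Zpos w - 12 * (Zpos w / 2)) / 2)); auto; lia.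
Qed.

Lemma run_to_descendant st j w m b :
  descendant j w -> m < 12 * Zpos j + 4 ->
  clear_run st m (first_u j) (first_v j) b ->
  exists b', reach b (sq (first_u j) (first_v j)) b' (sq (first_u w) (first_v w)) /\
    clear_run st m (first_u w) (first_v w) b'.
Proof.
  intros D Hm Hc; induction D as [|w D (b1 & R1 & C1)|w D (b1 & R1 & C1)].
  - exists b; split; [left; auto|exact Hc].
  - pose proof (descendant_ge _ _ D); pose proof (height_nonneg w).
    destruct (run_to_column _ _ _ _ C1) as (b2 & R2 & C2).
    destruct (run_column st w m (Z.to_nat (6 * height w + 12)) (first_v w) b2)
      as (b3 & R3 & C3); auto; try (unfold first_v; lia).
    exists b3.
    replace (first_u (xO w)) with (12 * Zpos w + 4) by (unfold first_u; lia).
    replace (first_v (xO w)) with (first_v w + 2 * Z.of_nat (Z.to_nat (6 * height w + 12)))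
      by (unfold first_v; cbn [height]; lia).
    split; [|exact C3].
    eapply reach_trans; [exact R1|eapply reach_trans; [exact R2|exact R3]].
  - pose proof (descendant_ge _ _ D); pose proof (height_nonneg w).
    destruct (run_to_column _ _ _ _ C1) as (b2 & R2 & C2).
    destruct (run_column st w m (Z.to_nat (6 * height w + 6)) (first_v w) b2)
      as (b3 & R3 & C3); auto; try (unfold first_v; lia).
    exists b3.
    replace (first_u (xI w)) with (12 * Zpos w + 4) by (unfold first_u; lia).
    replace (first_v (xI w)) with (first_v w + 2 * Z.of_nat (Z.to_nat (6 * height w + 6)))
      by (unfold first_v; cbn [height]; lia).
    split; [|exact C3].
    eapply reach_trans; [exact R1|eapply reach_trans; [exact R2|exact R3]].
Qed.

Lemma run_to_stop st j w m b :
  descendant j w -> m < 12 * Zpos j + 4 ->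
  clear_run st m (first_u j) (first_v j) b ->
  exists b', jchain bpawn b (sq (first_u j) (first_v j)) b'
                    (sq (first_u (xO w)) (first_v (xO w))) /\
    b' (sq (first_u (xO w)) (first_v (xO w))) = Some bpawn /\
    forall u' v', m < u' -> first_v (xO w) - 4 < v' \/ first_u (xO w) < u' ->
      u' <> first_u (xO w) \/ first_v (xO w) < v' -> b' (sq u' v') = init st u' v'.
Proof.
  intros D Hm Hc; pose proof (descendant_ge _ _ D); pose proof (height_nonneg w).
  destruct (run_to_descendant st j w m b D Hm Hc) as (b1 & R1 & C1).
  destruct (run_to_column _ _ _ _ C1) as (b2 & R2 & C2).
  (* The column takes [6 * height w + 12] jumps; the last two are made separately. Four squares
     below the stop, [clear_run] still describes the squares to the left of the stop, which the
     gadget needs, and the two remaining jumps change the column only. *)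
  destruct (run_column st w m (Z.to_nat (6 * height w + 10)) (first_v w) b2)
    as (b3 & R3 & C3); auto; try (unfold first_v; lia).
  assert (Ht : first_v w + 2 * Z.of_nat (Z.to_nat (6 * height w + 10)) + 2 * 1 + 2 * 1
               = first_v (xO w)) by (unfold first_v; cbn [height]; lia).
  remember (first_v w + 2 * Z.of_nat (Z.to_nat (6 * height w + 10))) as v eqn:Ev.
  replace (first_u (xO w)) with (12 * Zpos w + 4) by (unfold first_u; lia).
  rewrite <- Ht; unfold first_v in Ev.
  destruct (clear_run_jump st m (12 * Zpos w + 4) v b3 0 1) as [J4 C4]; auto.
  - right; auto.
  - lia.
  - rewrite Z.add_0_r, column_content by lia.
    destruct (Z.eqb_spec ((v + 1) mod 2) 0); [lia|reflexivity].
  - rewrite Z.mul_0_r, Z.add_0_r, column_content by lia.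
    destruct (Z.eqb_spec ((v + 2 * 1) mod 2) 0); [reflexivity|lia].
  - rewrite Z.mul_0_r, Z.add_0_r in J4, C4.
    remember (jumped (12 * Zpos w + 4) v 0 1 b3) as b4 eqn:E4.
    destruct (clear_run_jump st m (12 * Zpos w + 4) (v + 2 * 1) b4 0 1) as [J5 C5]; auto.
    + right; auto.
    + lia.
    + rewrite Z.add_0_r, column_content by lia.
      destruct (Z.eqb_spec ((v + 2 * 1 + 1) mod 2) 0); [lia|reflexivity].
    + rewrite Z.mul_0_r, Z.add_0_r, column_content by lia.
      destruct (Z.eqb_spec ((v + 2 * 1 + 2 * 1) mod 2) 0); [reflexivity|lia].
    + rewrite Z.mul_0_r, Z.add_0_r in J5, C5.
      exists (jumped (12 * Zpos w + 4) (v + 2 * 1) 0 1 b4).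
      assert (R4 : reach b (sq (first_u j) (first_v j)) b4
                     (sq (12 * Zpos w + 4) (v + 2 * 1))).
      { repeat (eapply reach_trans; [eassumption|]); right; exact J4. }
      split; [|split; [apply C5|]].
      * destruct R4 as [[-> E]|R4]; [rewrite <- E; exact J5|].
        exact (jchain_trans _ _ _ _ _ _ _ R4 J5).
      * intros u' v' Hu' Hv' Hn; subst b4; unfold jumped.
        rewrite !update_sq_neq by lia; apply C3; lia.
Qed.

(* [init] inside a stop tile; only the wire leaving it on the right reaches
   the next tile, in row 4. *)
Definition stop_content (a b : Z) : option piece :=
  let inside a b := (a <? 12) && in_path Stop a b in
  if inside a b then path_content Stop a b
  else if inside (a + 1) b || inside (a + 2) b
          || inside a (b + 1) || inside a (b + 2) then Some rpawn
  else if (a =? 7) && (b =? 6) then Some rpawn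
  else if (a =? 7) && (b =? 7) then Some bking else Some bpawn.

Lemma stop_init st p a b : st p = true -> 0 <= a < 12 -> 0 <= b < 10 ->
  a < 10 \/ b <> 4 ->
  init st (12 * Zpos p + a) (12 * (2 * height p + 2) + b) = stop_content a b.
Proof.
  intros Hst Ha Hb Hab.
  pose proof (tile_top st p) as Ht; rewrite Hst in Ht.
  assert (Hin : forall a' b', 0 <= a' < 14 -> 0 <= b' < 12 -> a' < 12 \/ b' <> 4 ->
    path st (12 * Zpos p + a') (12 * (2 * height p + 2) + b')
    = (a' <? 12) && in_path Stop a' b').
  { intros a' b' Ha' Hb' Hab'; destruct (Z.ltb_spec a' 12).
    - rewrite path_local, Ht by lia; reflexivity.
    - replace (12 * Zpos p + a') with (12 * (Zpos p + 1) + (a' - 12)) by ring.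
      rewrite path_local by lia.
      destruct (tile_at st (Zpos p + 1) _); cbn [in_path andb]; lia. }
  unfold init, stop_content.
  rewrite !local_div, !local_mod, Ht, <- !Z.add_assoc, !Hin by lia.
  reflexivity.
Qed.

(** A finite check against [stop_content]. The column at and below the stop is exempt, as the runner
    has just come up through it. *)
Lemma stop_armed st p u v b :
  st p = true -> u = 12 * Zpos p + 4 -> v = 12 * (2 * height p + 2) + 4 ->
  b (sq u v) = Some bpawn ->
  (forall u' v', u - 3 < u' -> v - 4 < v' -> u' <> u \/ v < v' -> b (sq u' v') = init st u' v') ->
  matches (sq u v) armed b.
Proof.
  intros Hst -> -> Hr Hb q c Hin.
  apply in_map_iff in Hin as ([[x y] c'] & [= <- ->] & Hin); cbn [fst snd].
  replace (off _ _) with (sq (12 * Zpos p + 4 + x) (12 * (2 * height p + 2) + 4 + y))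
    by (unfold off, sq; cbn [fst snd]; f_equal; ring).
  assert (Hcheck : forallb (fun e =>
    let '(x, y, c) := e in
    ((x =? 0) && (y =? 0) && content_implies (Is (Some bpawn)) c && content_implies c (Is (Some bpawn))) ||
    ((-3 <? x) && (x <? 7) && (-4 <? y) && (y <? 6) && (negb (x =? 0) || (0 <? y))
     && ((x <? 6) || negb (y =? 0))
     && content_implies (Is (stop_content (4 + x) (4 + y))) c)) armed_cells = true)
    by (vm_compute; reflexivity).
  rewrite forallb_forall in Hcheck; specialize (Hcheck _ Hin); cbv beta iota in Hcheck.
  apply orb_prop in Hcheck as [H|H].
  - assert (x = 0 /\ y = 0) as [-> ->] by lia.
    rewrite !Z.add_0_r, Hr.
    apply andb_prop in H as [_ H].
    destruct c as [[[[|] [|]]|]| |]; try discriminate; reflexivity.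
  - apply andb_prop in H as [H Hc].
    rewrite Hb, <- !Z.add_assoc, stop_init by (auto; lia).
    set (o := stop_content (4 + x) (4 + y)) in *.
    destruct o as [[[|] [|]]|], c as [[[[|] [|]]|]| |]; try discriminate;
      simpl; auto; intros ? [= <-]; reflexivity.
Qed.

(** The margin 6 exceeds the width of what a defusing reply can change, and stays short of column
    [j], which is at least 12 to the right of the stop. *)
Definition to_run (st : positive -> bool) (j : positive) (p : position) : Prop :=
  pturn p = Black /\ only_red_pawns (pboard p) /\
  pboard p (sq (first_u j) (first_v j)) = Some bpawn /\
  forall u v, first_u j < u -> v = first_v j \/ first_u j + 6 < u ->
    pboard p (sq u v) = init st u v.

Definition just_stopped (st : positive -> bool) (j : positive) (p : position) : Prop :=
  pturn p = Red /\ only_red_pawns (pboard p) /\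
  matches (sq (first_u j) (first_v j)) armed (pboard p) /\
  forall u v, first_u j < u -> pboard p (sq u v) = init st u v.

(** Only a simple move of the pawn on (1,1) or (3,1) fails to preserve [threat]. Such a move stays
    above the row of the stop, so the wire to the right remains open. *)
Lemma just_stopped_move st j p q : just_stopped st j p -> move p q ->
  (pturn q = Black /\ only_red_pawns (pboard q) /\
   matches (sq (first_u j) (first_v j)) threat (pboard q)) \/ to_run st j q.
Proof.
  intros (T & R & M & Hf) Hm.
  pose proof (move_only_red_pawns _ _ Hm R) as R'.
  assert (T' : pturn q = Black) by (destruct Hm as [-> _]; rewrite T; reflexivity).
  destruct (red_move_matches (sq (first_u j) (first_v j)) [sq 1 1; sq 3 1]
              armed threat threat p q) as [H|(s & dx & Hs & Hdx & _ & Hl & E)];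
    try assumption; try reflexivity.
  { apply weaker_sound with armed; [vm_compute; reflexivity|exact M]. }
  { left; auto. }
  right; split; [exact T'|]; split; [exact R'|].
  assert (Hcells : exists a b a' b', off (sq (first_u j) (first_v j)) s = sq a b /\
    off (sq (first_u j) (first_v j)) (off s (dx, -1)) = sq a' b' /\
    first_u j <= a <= first_u j + 6 /\ first_v j < b /\
    first_u j <= a' <= first_u j + 6 /\ first_v j < b').
  { assert (Hno : forall x y, occupied armed (sq x y) = true -> off s (dx, -1) = sq x y -> False).
    { intros x y Ho Es; rewrite Es in Hl; exact (occupied_sound _ _ _ _ M Ho Hl). }
    (* The steps down to (1,0) and (3,0) are blocked by red pawns, which leaves (1,1) to (0,1) and
       (3,1) to (2,1). *)
    destruct Hs as [<-|[<-|[]]], Hdx as [-> | ->].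
    - destruct (Hno 1 0); reflexivity.
    - exists (first_u j + 1), (first_v j + 1), (first_u j), (first_v j + 1).
      unfold off, sq; cbn [fst snd]; repeat split; try lia; f_equal; lia.
    - destruct (Hno 3 0); reflexivity.
    - exists (first_u j + 3), (first_v j + 1), (first_u j + 2), (first_v j + 1).
      unfold off, sq; cbn [fst snd]; repeat split; try lia; f_equal; lia. }
  destruct Hcells as (a & b & a' & b' & Ea & Ea' & Ha & Hb & Ha' & Hb').
  rewrite Ea, Ea' in E; split.
  - rewrite E, !update_sq_neq by lia.
    pose proof (lookup_sound _ _ _ (sq 0 0) (Is (Some bpawn)) M eq_refl) as H.
    replace (off _ _) with (sq (first_u j) (first_v j)) in H
      by (unfold off, sq; cbn [fst snd]; f_equal; ring).
    exact H.
  - intros u v Hu Hv; rewrite E, !update_sq_neq by lia; apply Hf, Hu.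
Qed.

Lemma to_run_clear st j p : to_run st j p ->
  clear_run st (first_u j + 6) (first_u j) (first_v j) (pboard p).
Proof.
  intros (_ & _ & Hr & Hf); split; [exact Hr|].
  intros u v H; apply Hf; lia.
Qed.

Lemma runner_move p b' s s' :
  pturn p = Black -> jchain bpawn (pboard p) s b' s' -> move p (Pos b' Red).
Proof.
  intros T H; split; [rewrite T; reflexivity|].
  exists b'; split; [reflexivity|].
  right; left; exists bpawn, s, s'; rewrite T; auto.
Qed.

Lemma to_run_can_move st j p : to_run st j p -> exists q, move p q /\ pturn q = Red.
Proof.
  intros H; pose proof (proj1 H) as T; apply to_run_clear in H.
  unfold first_u, first_v in H.
  destruct (clear_run_jump st _ _ _ _ 1 0 H) as [Hj _].
  - left; auto.
  - lia.
  - rewrite Z.add_0_r, row_content by lia.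
    destruct (Z.eqb_spec ((12 * (Zpos j / 2) + 4 + 1) mod 2) 0); [lia|reflexivity].
  - rewrite Z.mul_0_r, Z.add_0_r, row_content by lia.
    destruct (Z.eqb_spec ((12 * (Zpos j / 2) + 4 + 2 * 1) mod 2) 0); [reflexivity|lia].
  - eexists; split; [eapply runner_move; eassumption|reflexivity].
Qed.

Lemma to_run_stop st j w p : to_run st j p -> descendant j w -> st w = true ->
  exists q, move p q /\ just_stopped st (xO w) q.
Proof.
  intros H D Hst; pose proof H as (T & R & _); apply to_run_clear in H.
  pose proof (descendant_ge _ _ D); pose proof (height_nonneg w).
  assert (Hlt : first_u j + 6 < 12 * Zpos j + 4) by (unfold first_u; lia).
  destruct (run_to_stop st j w _ _ D Hlt H) as (b' & Hj & Hr & Hf).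
  assert (Hm : move p (Pos b' Red)) by (eapply runner_move; eassumption).
  exists (Pos b' Red); split; [exact Hm|].
  split; [reflexivity|]; split; [exact (move_only_red_pawns _ _ Hm R)|]; cbn [pboard].
  unfold first_u in *; unfold first_v in *; cbn [height] in *.
  split.
  - apply stop_armed with st w; auto; try lia.
    intros u' v' Hu' Hv' Hn; apply Hf; lia.
  - intros u' v' Hu'; apply Hf; lia.
Qed.

(** Below [j], the address of [f k] is [k] turns [xI] followed by one turn [xO]. *)
Lemma label_limit A k : forall j f, label A j = OL f ->
  exists w, descendant j w /\ label A w = f k.
Proof.
  induction k as [|k IH]; intros j f E.
  - exists (xO j); split; [apply descendant_xO, descendant_refl|].
    cbn [label]; rewrite E; reflexivity.
  - destruct (IH (xI j) (fun n => f (S n))) as (w & D & L).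
    + cbn [label]; rewrite E; reflexivity.
    + exists w; split; [|exact L].
      apply descendant_trans with (2 := D), descendant_xI, descendant_refl.
Qed.

(** Shows that the stops below [j] witness the whole label. A successor without a stop is at most 1
    and is absorbed by [H1]; a limit is exhausted by descendants that carry its terms. *)
Lemma label_bound A a : ole (OS OZ) a -> forall o j, label A j = o ->
  (forall w, descendant j w -> stops A w = true -> ole (OS (label A (xO w))) a) ->
  ole o a.
Proof.
  intros H1; induction o as [|x _|f IH]; intros j E H.
  - apply ole_zero.
  - assert (Ex : label A (xO j) = x) by (cbn [label]; rewrite E; reflexivity).
    destruct (classic (ole (OS OZ) x)) as [Hx|Hx].
    + rewrite <- Ex; apply H; [apply descendant_refl|].
      apply stops_intro; rewrite Ex; assumption.
    + apply ole_trans with (2 := H1), ole_succ, ole_one_or_zero, Hx.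
  - apply ole_limiting; intros k.
    destruct (label_limit A k j f E) as (w & D & L).
    apply (IH k w L); intros w' D'; apply H, descendant_trans with (1 := D), D'.
Qed.

(** Both claims go by one induction on the derivation. If Red leaves [threat] in place there is no
    value at all, so a derivation must use a defusing move, and this turn accounts for the [OS]. *)
Lemma lower_bound A p a : val_le p a ->
  (forall j, to_run (stops A) j p -> ole (label A j) a) /\
  (forall j, just_stopped (stops A) j p -> ole (OS (label A j)) a).
Proof.
  induction 1 as [p a [T W]|p q b a T Hm V [IH _] Hlt|p a T W Hq IH].
  - split; intros j Hj.
    + destruct (to_run_can_move _ _ _ Hj) as (q & Hm & _); destruct (W q Hm).
    + destruct Hj as (T' & _); congruence.
  - split; intros j Hj; [destruct Hj as (T' & _); congruence|].
    destruct (just_stopped_move _ _ _ _ Hj Hm) as [(T' & R & M)|Hr].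
    + destruct (threat_no_value _ _ _ T' R M V).
    + apply ole_trans with (2 := Hlt), ole_succ, IH, Hr.
  - split; intros j Hj; [|destruct Hj as (T' & _); congruence].
    apply (label_bound A a) with j; [|reflexivity|].
    + destruct (to_run_can_move _ _ _ Hj) as (q & Hm & T').
      (* Black can pass the turn to Red, and a value with Red to move is at least 1, as
         [label_bound] requires. *)
      destruct (Hq q Hm) as [q a [T2 _]|q r b a _ _ _ Hlt|q a T2 _ _]; try congruence.
      apply ole_trans with (2 := Hlt), ole_succ, ole_zero.
    + intros w D Hst; destruct (to_run_stop _ _ _ _ Hj D Hst) as (q & Hm & Hs).
      apply (IH q Hm), Hs.
Qed.

(** * The starting positions and the conclusion *)

Lemma start_to_run st : to_run st xH (Pos (start_board st) Black).
Proof.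
  split; [reflexivity|]; split; [|split; [reflexivity|]].
  - intros s pc; cbn [pboard]; unfold start_board.
    destruct (sq_eqb _ _); [intros [= <-]; discriminate|].
    destruct (_ =? _); [apply init_red|discriminate].
  - intros u v Hu _; apply start_board_sq; intros [= -> ->].
    unfold first_u in Hu; cbn in Hu; lia.
Qed.

Lemma start_valid st : valid_position (Pos (start_board st) Black).
Proof.
  intros s Hs; cbn [pboard]; unfold start_board.
  destruct (sq_eqb_spec s (sq 4 4)) as [->|_].
  - destruct Hs; exists 4; reflexivity.
  - destruct (Z.eqb_spec ((fst s + snd s) mod 2) 0) as [E|_]; [|reflexivity].
    destruct Hs; exists ((fst s + snd s) / 2); lia.
Qed.

Lemma empty_board_won : won_open (Pos (fun _ => None) Black).
Proof.
  assert (Hj : forall pc s b' s', ~ jump_step pc (fun _ => None) s b' s').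
  { intros pc s b' s' (dx & dy & _ & H & _); discriminate. }
  split; [reflexivity|].
  intros q (_ & b' & _ & [H|[(pc & s & s' & _ & H)|(pc & s & _ & H)]]); cbn [pboard] in H.
  - destruct H as (s & pc & dx & dy & H & _); discriminate.
  - remember (fun _ => None) as b eqn:Eb in H.
    destruct H; subst; eapply Hj; eassumption.
  - destruct H as (ss & bs & _ & E & Hstep & _).
    specialize (Hstep O); rewrite E in Hstep; eapply Hj; eassumption.
Qed.

Theorem theorem3 :
  forall a : ord, exists p : position, valid_position p /\ has_value p a.
Proof.
  intros a; destruct (classic (ole (OS OZ) a)) as [H1|H0].
  - exists (Pos (start_board (stops a)) Black); split; [apply start_valid|split].
    + apply (upper_bound a xH 4 4); auto using ole_refl, start_ready.
    + intros b Hb V; apply (not_ole_OS_self b), ole_trans with (1 := Hb).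
      apply (proj1 (lower_bound a _ _ V) xH), start_to_run.
  - exists (Pos (fun _ => None) Black); split; [intros s _; reflexivity|split].
    + apply vl_won, empty_board_won.
    + intros b Hb _; apply (not_ole_OS_self b), ole_trans with (1 := Hb).
      apply ole_trans with OZ; [apply ole_one_or_zero, H0|apply ole_zero].
Qed.
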